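(* Let $d\ge 1$ and let $X,X_1,X_2,\ldots$ be independent, identically distributed random vectors in $\mathbb{R}^d$ whose common distribution $\mu$ has a density $f$ with respect to Lebesgue measure. Assume that there are $\beta\in(0,1)$, $c_{max}<\infty$ and $\delta>0$ such that, for any $r,s>0$ and any $x,z\in\mathrm{supp}(\mu)$ with $\|x-z\|\ge\max\{r,s\}$ and $\mu(S(x,r))=\mu(S(z,s))\le\delta$, one has $$\frac{\mu\left(S(x,r)\cap S(z,s)\right)}{\mu\left(S(z,s)\right)}\le\beta\qquad\text{and}\qquad \mu\left(S(z,2s)\right)\le c_{max}\,\mu\left(S(z,s)\right).$$ For $n\ge 2$ let $R_{i,n}:=\min_{j\ne i,\ 1\le j\le n}\|X_i-X_j\|$ for $1\le i\le n$, and $P_n:=\max_{1\le i\le n}\mu\big(S(X_i,R_{i,n})\big)$. Then for every $y\in\mathbb{R}$, as $n\to\infty$, the random variables $$\sum_{i=1}^n\mathbb{I}\big\{n\,\mu(S(X_i,R_{i,n}))>y+\ln n\big\}$$ converge in distribution to the Poisson distribution with parameter $\exp(-y)$, and hence $$\lim_{n\to\infty}\mathbb{P}\left(nP_n-\ln n\le y\right)=\exp(-\exp(-y)),\qquad y\in\mathbb{R}.$$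
   Context: $\|\cdot\|$ is the Euclidean norm on $\mathbb{R}^d$; $S(x,r):=\{y\in\mathbb{R}^d:\|y-x\|\le r\}$ is the closed ball with center $x$ and radius $r$; $\mathbb{I}\{\cdot\}$ is the indicator function. The support of $\mu$ is $\mathrm{supp}(\mu):=\{x\in\mathbb{R}^d:\mu(S(x,r))>0\text{ for each }r>0\}$. Note that $\mu(S(X_i,R_{i,n}))$ is the random variable obtained by evaluating the function $(x,r)\mapsto\mu(S(x,r))$ at $(X_i,R_{i,n})$. *)

(* Defs.v *)
From HB Require Import structures.
From mathcomp Require Import all_boot all_order all_algebra finmap.
From mathcomp Require Import all_classical all_reals all_analysis measurable_realfun.

Set Implicit Arguments.
Unset Strict Implicit.
Unset Printing Implicit Defensive.

Import Order.TTheory GRing.Theory Num.Theory.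
Import numFieldNormedType.Exports.

Local Open Scope classical_set_scope.
Local Open Scope ring_scope.

(* R^d is [d.-tuple R]: the library equips tuples with the product
   sigma-algebra, which here is the Borel sigma-algebra of R^d. *)

Section euclidean_space.
Context {R : realType} {d : nat}.
Implicit Types (x y : d.-tuple R) (r : R).

Definition eucl_dist x y : R :=
  Num.sqrt (\sum_(i < d) (tnth x i - tnth y i) ^+ 2).

Definition eucl_ball x r : set (d.-tuple R) := [set y | eucl_dist y x <= r].

Definition measure_supp (mu : set (d.-tuple R) -> \bar R) : set (d.-tuple R) :=
  [set x | forall r, 0 < r -> (0 < mu (eucl_ball x r))%E].

Lemma measurable_eucl_dist d1 (T : measurableType d1) (f g : T -> d.-tuple R) :
  measurable_fun setT f -> measurable_fun setT g ->
  measurable_fun setT (fun t => eucl_dist (f t) (g t)).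
Proof.
move=> mf mg; apply: measurableT_comp.
  by apply: continuous_measurable_fun; exact: sqrt_continuous.
apply: measurable_sum => i; apply: measurable_funX.
by apply: measurable_funB; apply: (measurableT_comp (measurable_tnth i)).
Qed.

Lemma measurable_eucl_ball (x : d.-tuple R) r : measurable (eucl_ball x r).
Proof.
rewrite /eucl_ball -[X in measurable X]setTI.
have me : measurable_fun setT (fun y => eucl_dist y x).
  exact: measurable_eucl_dist.
have := @measurable_itv R `]-oo, r] => mi.
rewrite (_ : [set _ | _] = (fun y => eucl_dist y x) @^-1` [set` `]-oo, r]]).
  exact: me.
by apply/seteqP; split => t /=; rewrite in_itv.
Qed.

End euclidean_space.

Section lebesgue_tuple.
Context {R : realType}.

Definition tuple_cons n (p : measurableTypeR R * n.-tuple R) : n.+1.-tuple R :=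
  [tuple of p.1 :: p.2].

Lemma measurable_tuple_cons n : measurable_fun setT (@tuple_cons n).
Proof.
have m1 : measurable_fun setT
    (fst : measurableTypeR R * n.-tuple R -> R) by exact: measurable_fst.
have m2 : measurable_fun setT
    (snd : measurableTypeR R * n.-tuple R -> n.-tuple R).
  exact: measurable_snd.
exact: (measurable_cons m1 m2).
Qed.

Section cons_measure.
Variables (n : nat) (m : {sigma_finite_measure set (n.-tuple R) -> \bar R}).

Definition cons_measure : set (n.+1.-tuple R) -> \bar R :=
  pushforward (lebesgue_measure \x m)%E (@tuple_cons n).

Let cons_measure0 : cons_measure set0 = 0%E.
Proof. by rewrite /cons_measure /pushforward preimage_set0 measure0. Qed.

Let cons_measure_ge0 A : (0 <= cons_measure A)%E.
Proof. rewrite /cons_measure /pushforward; exact: measure_ge0. Qed.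

Let cons_measure_sigma_additive : semi_sigma_additive cons_measure.
Proof.
move=> F mF tF mUF; rewrite /cons_measure /pushforward preimage_bigcup.
have mcons A : measurable A -> measurable (@tuple_cons n @^-1` A).
  by move=> mA; rewrite -[X in measurable X]setTI; exact: measurable_tuple_cons.
apply: measure_semi_sigma_additive.
- by move=> k; exact: mcons.
- apply/trivIsetP => /= i j _ _ ij; rewrite -preimage_setI.
  by move/trivIsetP : tF => /(_ _ _ _ _ ij) ->//; rewrite preimage_set0.
- by rewrite -preimage_bigcup; exact: mcons.
Qed.

HB.instance Definition _ := isMeasure.Build _ _ _ cons_measure
  cons_measure0 cons_measure_ge0 cons_measure_sigma_additive.

Lemma cons_measure_sigma_finite : sigma_finite setT cons_measure.
Proof.
have /sigma_finiteP[F [FT ndF Ffin]] := sigma_finiteT (@lebesgue_measure R).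
have /sigma_finiteP[G [GT ndG Gfin]] := sigma_finiteT m.
pose uncons (t : n.+1.-tuple R) : measurableTypeR R * n.-tuple R :=
  (thead t, [tuple of behead t]).
have unconsK : cancel uncons (@tuple_cons n).
  by move=> t; rewrite /tuple_cons /uncons /= -tuple_eta.
have consK : cancel (@tuple_cons n) uncons.
  move=> [a t]; rewrite /tuple_cons /uncons; congr (_, _) => //.
  exact/val_inj.
have muncons : measurable_fun setT uncons.
  apply: measurable_fun_pair => /=.
    exact: (@measurable_tnth _ R n.+1 ord0).
  apply/measurable_fun_tnthP => i.
  rewrite [X in measurable_fun _ X](_ : _ = @tnth n.+1 R ^~ (lift ord0 i)).
    exact: measurable_tnth.
  by apply/funext => t /=; rewrite [in RHS](tuple_eta t) tnthS.
exists (fun k => uncons @^-1` (F k `*` G k)).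
  rewrite -preimage_bigcup; apply/seteqP; split => // t _ /=.
  have [k1 _ Fk] : (\bigcup_k F k) (uncons t).1 by rewrite -FT.
  have [k2 _ Gk] : (\bigcup_k G k) (uncons t).2 by rewrite -GT.
  exists (maxn k1 k2) => //; split.
    by move: Fk; exact/subsetPset/ndF/leq_maxl.
  by move: Gk; exact/subsetPset/ndG/leq_maxr.
move=> k; have [mF Foo] := Ffin k; have [mG Goo] := Gfin k; split.
  by rewrite -[X in measurable X]setTI; apply: muncons => //; exact: measurableX.
rewrite /cons_measure /pushforward -comp_preimage (_ : _ \o _ = id).
  by rewrite preimage_id product_measure1E// lte_mul_pinfty// ge0_fin_numE.
by apply/funext => p /=; rewrite consK.
Qed.

HB.instance Definition _ := Measure_isSigmaFinite.Build _ _ _ cons_measure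
  cons_measure_sigma_finite.

End cons_measure.

(* The measure of R^0 is a unit point mass, and that of R^(n+1) is the image
   of lambda \x lambda^n by (a, t) |-> a :: t *)
Fixpoint lebesgue_tuple n : {sigma_finite_measure set (n.-tuple R) -> \bar R} :=
  match n with
  | 0 => \d_([tuple] : 0.-tuple R)
  | n'.+1 => cons_measure (lebesgue_tuple n')
  end.

Lemma lebesgue_tuple_box n (A : 'I_n -> set R) :
  (forall i, measurable (A i)) ->
  lebesgue_tuple n [set x | forall i, A i (tnth x i)] =
  (\prod_(i < n) lebesgue_measure (A i))%E.
Proof.
elim: n A => [|n IH] A mA.
  rewrite big_ord0 /= diracE mem_set//=; by case.
rewrite big_ord_recl -IH; last by move=> i; exact: mA.
rewrite /= /cons_measure /pushforward.
rewrite -product_measure1E; last 2 first.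
- exact: mA.
- have -> : [set x : n.-tuple R | forall i, A (lift ord0 i) (tnth x i)] =
    \bigcap_(i in [set: 'I_n]) ((@tnth n R ^~ i) @^-1` A (lift ord0 i)).
    by apply/seteqP; split=> x /= Ax; [move=> i _; exact: Ax|
                                       move=> i; exact: (Ax i I)].
  apply: fin_bigcap_measurable => // i _.
  by rewrite -[X in measurable X]setTI; exact: measurable_tnth.
congr ((_ \x _)%E _); apply/seteqP; split=> -[a t] /=.
  move=> H; split; first by have := H ord0.
  by move=> i; have := H (lift ord0 i); rewrite tnthS.
move=> [H0 H] i; case: (unliftP ord0 i) => [j|] ->; last exact: H0.
by rewrite tnthS; exact: H.
Qed.

End lebesgue_tuple.

Section random_vectors.
Context {dO : measure_display} {Omega : measurableType dO} {R : realType}.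
Variable P : probability Omega R.

Definition mutually_independent d' (T : measurableType d')
    (X : nat -> {RV P >-> T}) :=
  forall (J : {fset nat}) (A : nat -> set T), (forall i, measurable (A i)) ->
    P (\bigcap_(i in [set` J]) (X i @^-1` A i)) =
    (\prod_(i <- J) P (X i @^-1` A i))%E.

Definition common_distribution d' (T : measurableType d')
    (X : nat -> {RV P >-> T}) (mu : probability T R) :=
  forall i A, measurable A -> distribution P (X i) A = mu A.

Definition cvg_in_distribution (Y : nat -> {RV P >-> R})
    (nu : probability R R) :=
  forall x : R, {for x, continuous (fun t : R => nu `]-oo, t]%classic)} ->
    cdf (Y n) x @[n --> \oo] --> nu `]-oo, x]%classic.

End random_vectors.

Definition has_density d' (T : measurableType d') (R : realType)
    (mu lambda : {measure set T -> \bar R}) (f : T -> R) :=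
  [/\ measurable_fun setT f, forall x, 0 <= f x
    & forall A, measurable A -> mu A = (\int[lambda]_(x in A) (f x)%:E)%E].

Section poisson_law.
Context {R : realType}.

Definition natR (k : nat) : R := k%:R.

Lemma measurable_natR : measurable_fun setT natR.
Proof. by []. Qed.

HB.instance Definition _ := isMeasurableFun.Build _ _ _ _ natR measurable_natR.

(* the second argument of [poisson_prob] is a dummy *)
Definition poisson_law (rate : R) : probability R R :=
  distribution (poisson_prob rate 0) natR.

End poisson_law.

Section nearest_neighbor.
Context {R : realType} {d : nat}.
Implicit Types (x : nat -> d.-tuple R) (mu : set (d.-tuple R) -> \bar R).

(* The sample of size n is x 0, ..., x n.-1. For i < n and 2 <= n the index set
   of the minimum is nonempty, so that [fine] does not truncate it. *)
Definition nn_dist x n i : R :=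
  fine (\big[Order.min/+oo%E]_(j < n | j != i :> nat) (eucl_dist (x i) (x j))%:E).

Definition nn_mass mu x n i : R := fine (mu (eucl_ball (x i) (nn_dist x n i))).

(* 0 is neutral because the masses are nonnegative *)
Definition max_nn_mass mu x n : R :=
  \big[Num.max/0]_(i < n) nn_mass mu x n i.

End nearest_neighbor.

Section exceedances.
Context {dO : measure_display} {Omega : measurableType dO} {R : realType}.
Context {d : nat}.
Variables (mu : probability (d.-tuple R) R).
Variables (X : nat -> {mfun Omega >-> d.-tuple R}) (y : R) (n : nat).

Definition exceedances (w : Omega) : R :=
  \sum_(i < n)
    \1_[set v | y + ln n%:R < n%:R * nn_mass mu (X ^~ v) n i] w.

Lemma measurable_nn_dist i :
  measurable_fun setT (fun w => nn_dist (X ^~ w) n i).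
Proof.
apply: measurableT_comp; first exact: fine_measurable.
elim: (index_enum 'I_n) => [|j s IH].
  by under eq_fun do rewrite big_nil; exact: measurable_cst.
under eq_fun do rewrite big_cons.
case: (_ != _) => //; apply: measurable_mine => //.
by apply/measurable_EFinP; exact: measurable_eucl_dist.
Qed.

Lemma measurable_nn_mass i :
  measurable_fun setT (fun w => nn_mass mu (X ^~ w) n i).
Proof.
apply: measurableT_comp; first exact: fine_measurable.
pose B := [set p : Omega * d.-tuple R |
             eucl_dist p.2 (X i p.1) <= nn_dist (X ^~ p.1) n i].
rewrite (_ : (fun _ => _) = mu \o xsection B); last first.
  apply/funext => w /=; congr (mu _); apply/seteqP.
  by split => t /=; rewrite /xsection /= inE.
apply: measurable_fun_xsection; rewrite -[X in measurable X]setTI.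
suff mb : measurable_fun [set: Omega * d.-tuple R]
    (fun p => eucl_dist p.2 (X i p.1) <= nn_dist (X ^~ p.1) n i).
  by apply: (mb measurableT [set true]).
apply: measurable_fun_ler.
  by apply: measurable_eucl_dist => //; exact: measurableT_comp.
exact: (measurableT_comp (measurable_nn_dist i)).
Qed.

Lemma measurable_exceedances : measurable_fun setT exceedances.
Proof.
apply: measurable_sum => i; apply: measurable_indic.
rewrite -[X in measurable X]setTI.
have mb : measurable_fun [set: Omega]
    (fun w => y + ln n%:R < n%:R * nn_mass mu (X ^~ w) n i).
  apply: measurable_fun_ltr => //.
  by apply: measurable_funM => //; exact: measurable_nn_mass.
exact: (mb measurableT [set true]).
Qed.

HB.instance Definition _ := isMeasurableFun.Build _ _ _ _ exceedances
  measurable_exceedances.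

End exceedances.

(* Main.v *)
Require Import Defs.
From HB Require Import structures.
From mathcomp Require Import all_boot all_order all_algebra finmap.
From mathcomp Require Import all_classical all_reals all_analysis measurable_realfun.
From mathcomp Require Import ring lra.

(** Let [t = (y + ln n) / n] and let the cell of [x] be the ball around [x] of
    mass [t]. The point [X_i] exceeds the threshold iff no other sample point
    lies in its cell, so [k] given points that avoid each other's cells all
    exceed it with conditional probability [(1 - mu U) ^+ (n - k)], [U] being the
    union of their cells. By the Bonferroni inequalities it suffices to show that
    [n ^+ k] times the probability that [k] given points exceed the threshold
    tends to [exp (- k y)], uniformly in the [k] points. The lower bound is a
    union bound. For the upper bound, split off the cluster of one of the [k]
    points, i.e. its component in the intersection graph of the cells: since
    [1 - a - b <= (1 - a) (1 - b)], independence factors the expectation, and one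
    argues by induction on [k]. A singleton cluster contributes
    [n (1 - t) ^+ (n - k) --> exp (- y)]. A cluster of [c >= 2] points lies in a
    fixed dilation of its largest cell, which by doubling has probability
    [O(t ^ (c - 1))], while its cells cover mass at least [(2 - beta) t]; the
    contribution is [O((ln n) ^ (c - 1) * n ^ (beta - 1)) --> 0].

    The hypothesis gives doubling at [z] only if some ball far from [z] has the
    same mass; two distinct points of the support provide such a ball as soon as
    the mass is small, so small balls are doubling and the dilation can be
    iterated. *)

Set Implicit Arguments.
Unset Strict Implicit.
Unset Printing Implicit Defensive.

Import Order.TTheory GRing.Theory Num.Theory.
Import numFieldNormedType.Exports.

Local Open Scope classical_set_scope.
Local Open Scope ring_scope.

(** * The Poisson limit from factorial moments *)

Section bonferroni.
Context {R : realType}.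

Lemma alternating_binomial_sum (w m : nat) :
  \sum_(i < m.+1) (-1) ^+ i * 'C(w.+1, i)%:R = (-1) ^+ m * 'C(w, m)%:R :> R.
Proof.
elim: m => [|m IH]; first by rewrite big_ord1 !bin0.
by rewrite big_ord_recr /= IH exprS binS natrD; ring.
Qed.

(** Both sides count the pairs of a [j]-subset inside a [(j + i)]-subset of a set with [w]
    elements. *)
Lemma bin_subset (w j i : nat) :
  ('C(w, j + i) * 'C(j + i, j) = 'C(w, j) * 'C(w - j, i))%N.
Proof.
have [ltw|jiw] := ltnP w (j + i).
  rewrite bin_small// mul0n; have [wj|jw] := ltnP w j; first by rewrite bin_small.
  by rewrite (@bin_small (w - j))// ?muln0// ltn_subLR.
have jw : (j <= w)%N := leq_trans (leq_addr i j) jiw.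
have iwj : (i <= w - j)%N by rewrite leq_subRL.
have pos : (0 < j`! * i`! * (w - (j + i))`!)%N by rewrite !muln_gt0 !fact_gt0.
apply/eqP; rewrite -(eqn_pmul2r pos); apply/eqP.
have h1 := bin_fact jiw; have h2 := bin_fact (leq_addr i j).
have h3 := bin_fact jw; have h4 := bin_fact iwj.
rewrite addKn in h2; rewrite subnDA in h1 *.
transitivity (w`!).
  rewrite -h1 -h2; ring.
rewrite -h3 -h4; ring.
Qed.

(** By [bin_subset] the sum is ['C(w, j)] times an alternating partial sum of the binomials of
    [w - j]. For [w > j] that partial sum has the sign of its last term; for [w = j] it is [1], and
    for [w < j] everything vanishes. *)
Lemma bonferroni_nat (w j m : nat) :
  0 <= (-1) ^+ m * (\sum_(i < m.+1) (-1) ^+ i * ('C(j + i, j) * 'C(w, j + i))%:R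
                    - (w == j)%:R) :> R.
Proof.
under eq_bigr do rewrite mulnC bin_subset natrM mulrCA.
rewrite -mulr_sumr.
have [wj|jw|->] := ltngtP w j.
- by rewrite bin_small// mul0r subr0 mulr0.
- have -> : (w - j = (w - j.+1).+1)%N by rewrite subnSK.
  rewrite alternating_binomial_sum subr0 mulrCA mulrA -mulrA.
  by rewrite [X in _ * X]mulrA -exprD addnn -signr_odd odd_double expr0 mul1r mulr_ge0.
- rewrite subnn binn mul1r big_ord_recl /= bin0 big1 ?addr0 ?mulr1 ?subrr ?mulr0//.
  by move=> i _; rewrite bin0n mulr0.
Qed.

End bonferroni.

Section poisson_of_factorial_moments.
Context {R : realType}.

(** Double counting. If [p J] is the probability that a random set equals [J], this is the expected
    number of its [k]-subsets, that is, the [k]-th factorial moment of its size divided by [k!]. *)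
Lemma sum_supersets (I : finType) (p : {set I} -> R) k :
  \sum_(A : {set I} | #|A| == k) \sum_(J : {set I} | A \subset J) p J =
  \sum_J p J * 'C(#|J|, k)%:R.
Proof.
rewrite (exchange_big_dep xpredT)//=; apply: eq_bigr => J _.
rewrite sumr_const -[LHS]mulr_natr -cards_draws; congr (_ * _%:R).
by rewrite -sum1_card -[RHS]sum1_card; apply: eq_bigl => A; rewrite !inE andbC.
Qed.

(** [bonferroni_nat] for [w = #|J|], weighted by [p J] and summed over [J]. *)
Lemma bonferroni_weights (I : finType) (p : {set I} -> R) j m :
  (forall J, 0 <= p J) ->
  0 <= (-1) ^+ m * (\sum_(i < m.+1) (-1) ^+ i * 'C(j + i, j)%:R *
      (\sum_(A : {set I} | #|A| == (j + i)%N) \sum_(J : {set I} | A \subset J) p J)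
    - \sum_(J : {set I} | #|J| == j) p J).
Proof.
move=> p0.
rewrite (_ : _ * _ = \sum_J p J * ((-1) ^+ m * (\sum_(i < m.+1)
  (-1) ^+ i * ('C(j + i, j) * 'C(#|J|, j + i))%:R - (#|J| == j)%:R))).
  by apply: sumr_ge0 => J _; rewrite mulr_ge0// bonferroni_nat.
under [in RHS]eq_bigr do rewrite mulrCA.
rewrite -mulr_sumr; congr (_ * _).
under [in RHS]eq_bigr do rewrite mulrBr.
rewrite sumrB; congr (_ - _); last first.
  by rewrite big_mkcond; apply: eq_bigr => J _; case: eqP; rewrite ?mulr1 ?mulr0.
under eq_bigr do rewrite sum_supersets mulr_sumr.
rewrite exchange_big; apply: eq_bigr => J _; rewrite mulr_sumr.
by apply: eq_bigr => i _; rewrite natrM; ring.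
Qed.

Lemma cvg_invn : (n%:R^-1 : R) @[n --> \oo] --> (0 : R).
Proof.
by apply/gtr0_cvgV0; [near=> n; rewrite ltr0n; near: n; exact: nbhs_infty_gt
                     |exact: cvgr_idn].
Unshelve. all: by end_near. Qed.

Lemma ffact_le_expn n k : (n ^_ k <= n ^ k)%N.
Proof.
elim: k => [|k IH]; first by rewrite ffactn0.
by rewrite ffactnSr expnSr leq_mul// leq_subr.
Qed.

Lemma cvg_bin_over_exp k :
  ('C(n, k)%:R / n%:R ^+ k : R) @[n --> \oo] --> (k`!%:R^-1 : R).
Proof.
have H : ((n ^_ k)%:R / n%:R ^+ k : R) @[n --> \oo] --> (1 : R).
  elim: k => [|k IH].
    by apply: cvg_near_cst; apply: nearW => n; rewrite ffactn0 expr0 divr1.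
  have c : (1 - k%:R * n%:R^-1 : R) @[n --> \oo] --> (1 - k%:R * 0 : R).
    exact: (cvgB (cvg_cst (1 : R)) (cvgM (cvg_cst (k%:R : R)) cvg_invn)).
  rewrite mulr0 subr0 in c.
  have h : ((n ^_ k)%:R / n%:R ^+ k * (1 - k%:R * n%:R^-1) : R) @[n --> \oo] --> (1 : R).
    by rewrite -[1 in X in _ --> X]mulr1; exact: (cvgM IH c).
  apply: cvg_trans (near_eq_cvg _) h; near=> n.
  have n0 : n%:R != 0 :> R by rewrite pnatr_eq0 -lt0n; near: n; exact: nbhs_infty_gt.
  have kn : (k <= n)%N by near: n; exact: nbhs_infty_ge.
  by rewrite ffactnSr natrM exprSr natrB//; field; rewrite n0 expf_neq0.
have h : ((n ^_ k)%:R / n%:R ^+ k * k`!%:R^-1 : R) @[n --> \oo] --> (k`!%:R^-1 : R).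
  by rewrite -[X in _ --> X]mul1r; exact: (cvgM H (cvg_cst (k`!%:R^-1 : R))).
apply: cvg_trans (near_eq_cvg _) h; near=> n => /=.
rewrite -bin_ffact natrM.
have : k`!%:R != 0 :> R by rewrite pnatr_eq0 -lt0n fact_gt0.
by move=> k0; rewrite mulrAC mulfK.
Unshelve. all: by end_near. Qed.

(** Even truncations lie above [v] and odd ones below it. Two consecutive truncations whose limits
    are both close to [l] therefore enclose [v]. *)
Lemma cvg_alternating_bounds (u : nat -> nat -> R) (v a : nat -> R) (l : R) :
  (forall m n, 0 <= (-1) ^+ m * (u m n - v n)) ->
  (forall m, u m n @[n --> \oo] --> a m) -> a m @[m --> \oo] --> l ->
  v n @[n --> \oo] --> l.
Proof.
move=> uv ua al; apply/cvgrPdist_le => e e0.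
have e2 : 0 < e / 2 by rewrite divr_gt0.
have [N _ HN] : \forall m \near \oo, `|l - a m| <= e / 2.
  by move/cvgrPdist_le : al; apply.
have lo := HN N.*2 ltac:(by rewrite /= -addnn leq_addr).
have hi := HN N.*2.+1 ltac:(by rewrite /= -addnn leqW// leq_addr).
near=> n.
have u1 : `|a N.*2 - u N.*2 n| <= e / 2.
  by near: n; move: (ua N.*2) => /cvgrPdist_le; apply.
have u2 : `|a N.*2.+1 - u N.*2.+1 n| <= e / 2.
  by near: n; move: (ua N.*2.+1) => /cvgrPdist_le; apply.
have := uv N.*2 n; have := uv N.*2.+1 n.
rewrite exprS -signr_odd odd_double expr0 mulr1 mul1r.
move: lo hi u1 u2; rewrite !ler_norml => /andP[? ?] /andP[? ?] /andP[? ?] /andP[? ?].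
by move=> ? ?; apply/andP; split; lra.
Unshelve. all: by end_near. Qed.

(** Uniformity in [A] gives convergence of the sum over the ['C(n, k)] sets of size [k], with limit
    [lam ^+ k / k!]. The limits of the Bonferroni truncations are then partial sums of the
    exponential series at [- lam], up to the factor [lam ^+ j / j!]. *)
Lemma poisson_of_factorial_moments (lam : R) (p : forall n, {set 'I_n} -> R) :
  (forall n J, 0 <= p n J) ->
  (forall k (e : R), 0 < e -> \forall n \near \oo, forall A : {set 'I_n},
    #|A| = k -> `|n%:R ^+ k * (\sum_(J : {set 'I_n} | A \subset J) p n J) - lam ^+ k|
                <= e) ->
  forall j, (\sum_(J : {set 'I_n} | #|J| == j) p n J) @[n --> \oo] -->
    (lam ^+ j / j`!%:R * expR (- lam) : R).
Proof.
move=> p0 pk j.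
pose S k n := \sum_(A : {set 'I_n} | #|A| == k) \sum_(J : {set 'I_n} | A \subset J) p n J.
have cS k : S k n @[n --> \oo] --> (lam ^+ k / k`!%:R : R).
  apply/cvgrPdist_le => e e0.
  have e2 : 0 < e / 2 by rewrite divr_gt0.
  have c1 : (lam ^+ k * ('C(n, k)%:R / n%:R ^+ k) : R) @[n --> \oo] -->
      (lam ^+ k * k`!%:R^-1 : R).
    by apply: cvgM; [exact: cvg_cst|exact: cvg_bin_over_exp].
  near=> n.
  have n0 : 0 < n%:R :> R by rewrite ltr0n; near: n; exact: nbhs_infty_gt.
  have h1 : `|lam ^+ k * k`!%:R^-1 - lam ^+ k * ('C(n, k)%:R / n%:R ^+ k)| <= e / 2.
    by near: n; move/cvgrPdist_le : c1; apply.
  have h2 : forall A : {set 'I_n}, #|A| = k ->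
      `|n%:R ^+ k * (\sum_(J : {set 'I_n} | A \subset J) p n J) - lam ^+ k| <= e / 2.
    by near: n; exact: pk.
  rewrite (le_trans (ler_distD (lam ^+ k * ('C(n, k)%:R / n%:R ^+ k)) _ _))//.
  rewrite (splitr e) lerD//.
  have nk0 : 0 < n%:R ^+ k :> R by rewrite exprn_gt0.
  (* Multiplied by [n ^+ k], the difference is a sum of ['C(n, k) <= n ^+ k] errors, each at most
     [e / 2]. *)
  rewrite distrC -(ler_pM2l nk0) -[X in X * `|_|]gtr0_norm// -normrM mulrBr.
  rewrite mulrCA [X in _ - _ * X]mulrC divfK ?gt_eqF//.
  have -> : 'C(n, k)%:R = \sum_(A : {set 'I_n} | #|A| == k) 1 :> R.
    by rewrite sumr_const -[in LHS](card_ord n) -card_draws -mulr_natr mul1r cardsE.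
  rewrite /S !mulr_sumr -sumrB.
  apply: (le_trans (ler_norm_sum _ _ _)).
  apply: (@le_trans _ _ (\sum_(A : {set 'I_n} | #|A| == k) (e / 2))).
    by apply: ler_sum => A /eqP Ak; rewrite mulr1; exact: h2.
  rewrite sumr_const -[leLHS]mulr_natl; apply: ler_wpM2r; first exact: ltW.
  rewrite -cardsE card_draws card_ord -natrX ler_nat.
  rewrite -[leqLHS]muln1 (leq_trans (leq_mul (leqnn _) (fact_gt0 k)))//.
  by rewrite bin_ffact ffact_le_expn.
pose T m n := \sum_(i < m.+1) (-1) ^+ i * 'C(j + i, j)%:R * S (j + i)%N n.
(* ['C(j + i, j) / (j + i)! = 1 / (j! * i!)] separates [j] from the summation index. *)
pose a m := lam ^+ j / j`!%:R * series (exp_coeff (- lam)) m.+1.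
apply: (@cvg_alternating_bounds T _ a).
- by move=> m n; exact: bonferroni_weights.
- move=> m; have -> : a m = \sum_(i < m.+1) (-1) ^+ i * 'C(j + i, j)%:R *
      (lam ^+ (j + i) / (j + i)`!%:R).
    rewrite /a /series /= big_mkord mulr_sumr; apply: eq_bigr => i _.
    rewrite /exp_coeff /= (exprNn lam) exprD.
    have -> : (j + i)`!%:R = 'C(j + i, j)%:R * (j`!%:R * i`!%:R) :> R.
      by rewrite -!natrM -(bin_fact (leq_addr i j)) addKn.
    have f0 n : n`!%:R != 0 :> R by rewrite pnatr_eq0 -lt0n fact_gt0.
    have b0 : 'C(j + i, j)%:R != 0 :> R by rewrite pnatr_eq0 -lt0n bin_gt0 leq_addr.
    move: ((-1) ^+ i) (lam ^+ i) (lam ^+ j) => a1 a2 a3.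
    by field; rewrite !f0 b0.
  apply: cvg_big => [|i _]; first by apply: add_continuous.
  by apply: cvgM; [exact: cvg_cst|exact: cS].
- apply: cvgM; first exact: cvg_cst.
  rewrite cvg_shiftS; exact: is_cvg_series_exp_coeff.
Unshelve. all: by end_near. Qed.

End poisson_of_factorial_moments.

(** * Asymptotics of the threshold *)

Section asymptotics.
Context {R : realType}.
Variable y : R.

(* [thr n = L_n / n] where [n = exp (L_n - y)], so that every estimate below is
   one of [L_n ^+ m * exp (- a L_n) --> 0]. *)
Definition logy (n : nat) : R := y + ln n%:R.
Definition thr (n : nat) : R := logy n / n%:R.

Lemma cvg_logy : logy n @[n --> \oo] --> +oo.
Proof.
apply/cvgryPge => A; near=> n.
have n0 : (0 : R) < n%:R by rewrite ltr0n; near: n; exact: nbhs_infty_gt.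
rewrite /logy addrC -lerBlDr -[leLHS]expRK ler_ln ?posrE ?expR_gt0//.
by near: n; move: (@cvgr_idn R) => /cvgryPge; apply.
Unshelve. all: by end_near. Qed.

Lemma expR_logy n : (0 < n)%N -> expR (logy n) = expR y * n%:R.
Proof. by move=> n0; rewrite expRD lnK// posrE ltr0n. Qed.

Lemma cvg_logyX_expR (a : R) m : 0 < a ->
  logy n ^+ m * expR (- (a * logy n)) @[n --> \oo] --> (0 : R).
Proof.
move=> a0; have am0 : 0 < a ^+ m.+1 by rewrite exprn_gt0.
have f0 : 0 < (m.+1)`!%:R :> R by rewrite ltr0n fact_gt0.
pose c : R := (m.+1)`!%:R / a ^+ m.+1.
apply: (@squeeze_cvgr _ _ _ _ (fun=> 0) (fun n => c * (logy n)^-1)).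
- near=> n.
  have L0 : 0 < logy n by near: n; move: cvg_logy => /cvgryPgt; apply.
  apply/andP; split; first by rewrite mulr_ge0 ?expR_ge0// exprn_ge0// ltW.
  rewrite expRN ler_pdivrMr ?expR_gt0// mulrC.
  (* Keeping a single term of the exponential series bounds the product by [c / logy n]. *)
  have h := expR_ge1Dxn m (ltW (mulr_gt0 a0 L0)).
  have {}h : (a * logy n) ^+ m.+1 / (m.+1)`!%:R <= expR (a * logy n).
    by apply: le_trans h; rewrite lerDr.
  have cL : 0 <= c / logy n by rewrite mulr_ge0// ?invr_ge0 ?divr_ge0 ?ltW.
  apply: le_trans (ler_wpM2r cL h); rewrite le_eqVlt; apply/orP; left; apply/eqP.
  by rewrite /c exprMn !exprS; field; rewrite !gt_eqF ?exprn_gt0.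
- exact: cvg_cst.
- rewrite -[X in _ --> X](mulr0 c); apply: cvgM; first exact: cvg_cst.
  apply/gtr0_cvgV0; last exact: cvg_logy.
  by move: cvg_logy => /cvgryPgt; apply.
Unshelve. all: by end_near. Qed.

Lemma thr_gt0 : \forall n \near \oo, 0 < thr n.
Proof.
near=> n; rewrite divr_gt0//.
  by near: n; move: cvg_logy => /cvgryPgt; apply.
by rewrite ltr0n; near: n; exact: nbhs_infty_gt.
Unshelve. all: by end_near. Qed.

Lemma logyX_thr m n : (0 < n)%N ->
  logy n ^+ m * thr n = expR y * (logy n ^+ m.+1 * expR (- (1 * logy n))).
Proof.
move=> n0; rewrite mul1r expRN expR_logy// /thr exprSr.
by field; rewrite pnatr_eq0 -lt0n n0 gt_eqF ?expR_gt0.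
Qed.

Lemma cvg_logyX_thr m : logy n ^+ m * thr n @[n --> \oo] --> (0 : R).
Proof.
have h : expR y * (logy n ^+ m.+1 * expR (- (1 * logy n))) @[n --> \oo] --> (0 : R).
  rewrite -[X in _ --> X](mulr0 (expR y)); apply: cvgM; first exact: cvg_cst.
  exact: cvg_logyX_expR.
apply: cvg_trans (near_eq_cvg _) h; near=> n.
by rewrite logyX_thr//; near: n; exact: nbhs_infty_gt.
Unshelve. all: by end_near. Qed.

Lemma cvg_thr : thr n @[n --> \oo] --> (0 : R).
Proof.
apply: cvg_trans (near_eq_cvg _) (cvg_logyX_thr 0); near=> n.
by rewrite expr0 mul1r.
Unshelve. all: by end_near. Qed.

Lemma near_thr_le (e : R) : 0 < e -> \forall n \near \oo, thr n <= e.
Proof.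
move=> e0; near=> n; rewrite (le_trans (ler_norm _))// -normrN -[- _]add0r.
by near: n; move: cvg_thr => /cvgrPdist_le; apply.
Unshelve. all: by end_near. Qed.

Lemma le_expR_1Bx (u : R) k : u <= 1 -> (1 - u) ^+ k <= expR (- (k%:R * u)).
Proof.
move=> u1; rewrite -mulrN expRM_natl.
by rewrite lerXn2r ?nnegrE ?subr_ge0 ?expR_ge0// expR_ge1Dx.
Qed.

(** [(1 - u)^-1 = 1 + u / (1 - u)] is at most [expR (u / (1 - u))]; invert and take powers. *)
Lemma ge_expR_1Bx (u : R) k : 0 <= u < 1 ->
  expR (- (k%:R * (u / (1 - u)))) <= (1 - u) ^+ k.
Proof.
move=> /andP[u0 u1]; have v0 : 0 < 1 - u by rewrite subr_gt0.
rewrite -mulrN expRM_natl lerXn2r ?nnegrE ?expR_ge0 ?(ltW v0)//.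
rewrite expRN -[leRHS]invrK lef_pV2 ?posrE ?expR_gt0 ?invr_gt0//.
apply: le_trans (expR_ge1Dx _); rewrite le_eqVlt; apply/orP; left; apply/eqP.
by field; rewrite gt_eqF.
Qed.

(** [n ^+ c] is [expR (c * (logy n - y))], and [le_expR_1Bx] and [ge_expR_1Bx] bound the other
    factor by exponentials. The terms [c * logy n] cancel since [n * thr n = logy n], and [K] enters
    only through multiples of [K * thr n], which vanish in the limit. *)
Lemma cvg_expXpow (c K : nat) :
  n%:R ^+ c * (1 - c%:R * thr n) ^+ (n - K) @[n --> \oo] --> expR (- (c%:R * y)).
Proof.
have natE n : (0 < n)%N -> n%:R ^+ c = expR (c%:R * (logy n - y)) :> R.
  move=> n0; rewrite expRM_natl expRD expR_logy// expRN.
  by congr (_ ^+ _); field; rewrite gt_eqF ?expR_gt0.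
have thrE n : (0 < n)%N -> n%:R * thr n = logy n.
  by move=> n0; rewrite mulrC divfK// pnatr_eq0 -lt0n.
have exp_cvg (g : nat -> R) (l : R) : g n @[n --> \oo] --> l ->
    expR (g n) @[n --> \oo] --> expR l.
  by move=> gl; apply: continuous_cvg => //; exact: continuous_expR.
have up : expR (- (c%:R * y) + c%:R * K%:R * thr n) @[n --> \oo] -->
    expR (- (c%:R * y)).
  apply: exp_cvg; rewrite -[X in _ --> X]addr0 -[X in _ --> _ + X](mulr0 (c%:R * K%:R)).
  by apply: cvgD; [exact: cvg_cst|apply: cvgM; [exact: cvg_cst|exact: cvg_thr]].
have c1 : 1 - c%:R * thr n @[n --> \oo] --> (1 : R).
  rewrite -[X in _ --> X]subr0 -[X in _ --> _ - X](mulr0 (c%:R)).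
  by apply: cvgB; [exact: cvg_cst|apply: cvgM; [exact: cvg_cst|exact: cvg_thr]].
(* Passing from [u] to [u / (1 - u)], with [u = c * thr n], leaves a correction of order
   [logy n * thr n], which tends to [0]. *)
have lo : expR (- (c%:R * y) + c%:R * (K%:R * thr n - c%:R * (logy n * thr n))
    * (1 - c%:R * thr n)^-1) @[n --> \oo] --> expR (- (c%:R * y)).
  apply: exp_cvg; rewrite -[X in _ --> X]addr0; apply: cvgD; first exact: cvg_cst.
  have -> : 0 = c%:R * (K%:R * 0 - c%:R * 0) * 1^-1 :> R by rewrite !(mulr0, subr0, mul0r).
  apply: cvgM; last by apply: cvgV.
  apply: cvgM; first exact: cvg_cst.
  apply: cvgB; (apply: cvgM; first exact: cvg_cst); first exact: cvg_thr.
  by have := cvg_logyX_thr 1; under eq_cvg do rewrite expr1.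
apply: (squeeze_cvgr _ lo up); near=> n.
have n0 : (0 < n)%N by near: n; exact: nbhs_infty_gt.
have Kn : (K <= n)%N by near: n; exact: nbhs_infty_ge.
have t0 : 0 < thr n by near: n; exact: thr_gt0.
have ct0 : 0 <= c%:R * thr n by rewrite mulr_ge0// ltW.
have ct : c%:R * thr n <= 2^-1.
  (* Dividing by [c.+1] instead of [c] covers [c = 0]. *)
  rewrite mulrC; apply: (@le_trans _ _ (2^-1 / c.+1%:R * c%:R)).
    rewrite ler_wpM2r//; near: n; apply: near_thr_le.
    by rewrite divr_gt0 ?invr_gt0.
  by rewrite -mulrA ler_piMr ?invr_ge0// mulrC ler_pdivrMr// mul1r ler_nat.
have tn := thrE n n0.
have v0 : 1 - c%:R * thr n != 0 by rewrite gt_eqF//; lra.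
rewrite natE//; apply/andP; split.
- apply: le_trans (ler_wpM2l (expR_ge0 _) (ge_expR_1Bx _ _)); last first.
    by rewrite ct0/=; lra.
  rewrite -expRD ler_expR natrB//.
  rewrite le_eqVlt; apply/orP; left; apply/eqP.
  rewrite -[in X in _ = X]tn -[in X in X = _]tn. field.
  by [].
- apply: le_trans (ler_wpM2l (expR_ge0 _) (le_expR_1Bx _ _)) _; first by lra.
  rewrite -expRD ler_expR natrB// -tn le_eqVlt; apply/orP; left; apply/eqP.
  by ring.
Unshelve. all: by end_near. Qed.

(** As [n * thr n = logy n], the powers of [n] and [thr n] combine to [n * logy n ^+ c.-1], while
    the exponential is about [expR (- (2 - b) * logy n)]. The factor [n] costs one [logy n] in the
    exponent; what remains, [expR (- (1 - b) * logy n)], beats every power of [logy n]. *)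
Lemma cvg_cluster_bound (c K : nat) (C b : R) : (1 < c)%N -> 0 <= C -> b < 1 ->
  n%:R ^+ c * (C * thr n) ^+ c.-1 * expR (- ((n - K)%:R * ((2 - b) * thr n)))
    @[n --> \oo] --> (0 : R).
Proof.
case: c => [//|c] _ C0 b1 /=.
have up : C ^+ c * expR (- y) * (logy n ^+ c * expR (- ((1 - b) * logy n))) *
    expR ((2 - b) * K%:R * thr n) @[n --> \oo] --> (0 : R).
  have -> : 0 = C ^+ c * expR (- y) * 0 * expR ((2 - b) * K%:R * 0) :> R.
    by rewrite mulr0 mul0r.
  apply: cvgM.
    apply: cvgM; first exact: cvg_cst.
    by apply: cvg_logyX_expR; rewrite subr_gt0.
  apply: continuous_cvg; first exact: continuous_expR.
  by apply: cvgM; [exact: cvg_cst|exact: cvg_thr].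
apply: cvg_trans (near_eq_cvg _) up; near=> n.
have n0 : (0 < n)%N by near: n; exact: nbhs_infty_gt.
have Kn : (K <= n)%N by near: n; exact: nbhs_infty_ge.
have tn : n%:R * thr n = logy n by rewrite mulrC divfK// pnatr_eq0 -lt0n.
have nE : n%:R = expR (logy n - y).
  by rewrite expRD expR_logy// expRN; field; rewrite gt_eqF ?expR_gt0.
have key : n%:R * expR (- ((n - K)%:R * ((2 - b) * thr n))) =
    expR (- y) * expR (- ((1 - b) * logy n)) * expR ((2 - b) * K%:R * thr n).
  rewrite [X in X * _ = _]nE -!expRD natrB//; congr expR; rewrite -tn; ring.
transitivity (C ^+ c * logy n ^+ c *
    (n%:R * expR (- ((n - K)%:R * ((2 - b) * thr n))))).
  by rewrite key; ring.
by rewrite -tn !exprMn exprS; ring.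
Unshelve. all: by end_near. Qed.

End asymptotics.

(** * Euclidean balls *)

Section cauchy_schwarz.
Context {R : rcfType} {I : finType}.
Implicit Types a b : I -> R.

Lemma cauchy_schwarz a b :
  (\sum_i a i * b i) ^+ 2 <= (\sum_i a i ^+ 2) * (\sum_i b i ^+ 2).
Proof.
set A := \sum_i a i ^+ 2; set C := \sum_i a i * b i; set B := \sum_i b i ^+ 2.
have A0 : 0 <= A by apply: sumr_ge0 => i _; exact: sqr_ge0.
(* Nonnegativity of this sum gives the claim after division by [A]; if [A = 0] then every [a i]
   vanishes. *)
have H : \sum_i (A * b i - C * a i) ^+ 2 = A * (A * B - C ^+ 2).
  transitivity (\sum_i (A ^+ 2 * b i ^+ 2 - 2 * A * C * (a i * b i) +
                        C ^+ 2 * a i ^+ 2)).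
    by apply: eq_bigr => i _; ring.
  rewrite big_split sumrB /= -!mulr_sumr -/A -/B -/C; ring.
move: A0; rewrite le_eqVlt => /predU1P[A0|A0].
  have a0 i : a i = 0.
    apply/eqP; rewrite -sqrf_eq0; apply/eqP.
    by apply: (psumr_eq0P _ (esym A0)) => // j _; exact: sqr_ge0.
  by rewrite /C big1 ?expr0n/= -?A0 ?mul0r// => i _; rewrite a0 mul0r.
rewrite -subr_ge0 -(pmulr_rge0 _ A0) -H.
by apply: sumr_ge0 => i _; exact: sqr_ge0.
Qed.

Lemma minkowski2 a b : Num.sqrt (\sum_i (a i + b i) ^+ 2) <=
  Num.sqrt (\sum_i a i ^+ 2) + Num.sqrt (\sum_i b i ^+ 2).
Proof.
have s0 c : 0 <= \sum_i c i ^+ 2 :> R by apply: sumr_ge0 => i _; exact: sqr_ge0.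
rewrite -(@ler_pXn2r _ 2)// ?nnegrE ?addr_ge0 ?sqrtr_ge0//.
rewrite sqrrD !sqr_sqrtr// -sqrtrM//.
rewrite (_ : \sum_i (a i + b i) ^+ 2 = \sum_i a i ^+ 2 +
  (\sum_i a i * b i) *+ 2 + \sum_i b i ^+ 2); last first.
  by rewrite -sumrMnl -!big_split; apply: eq_bigr => i _; rewrite sqrrD.
rewrite lerD2r lerD2l lerMn2r/= (le_trans (ler_norm _))// -sqrtr_sqr.
by rewrite ler_wsqrtr// cauchy_schwarz.
Qed.

End cauchy_schwarz.

Section eucl_dist_theory.
Context {R : realType} {d : nat}.
Implicit Types (x y z : d.-tuple R) (r s : R).

Lemma eucl_dist_ge0 x y : 0 <= eucl_dist x y.
Proof. exact: sqrtr_ge0. Qed.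

Lemma eucl_distC x y : eucl_dist x y = eucl_dist y x.
Proof.
by congr Num.sqrt; apply: eq_bigr => i _; rewrite -sqrrN opprB.
Qed.

Lemma eucl_distxx x : eucl_dist x x = 0.
Proof.
by rewrite /eucl_dist big1 ?sqrtr0// => i _; rewrite subrr expr0n.
Qed.

Lemma eucl_dist_triangle y x z :
  eucl_dist x z <= eucl_dist x y + eucl_dist y z.
Proof.
apply: le_trans (minkowski2 _ _); rewrite le_eqVlt; apply/orP; left; apply/eqP.
by congr Num.sqrt; apply: eq_bigr => i _; rewrite addrA subrK.
Qed.

Lemma sub_eucl_ball x z r s :
  eucl_dist x z + r <= s -> eucl_ball x r `<=` eucl_ball z s.
Proof.
move=> xzrs y; rewrite /eucl_ball /= => yx.
by rewrite (le_trans (eucl_dist_triangle x _ _))// (le_trans _ xzrs)// addrC lerD2l.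
Qed.

Lemma le_eucl_ball x r s : r <= s -> eucl_ball x r `<=` eucl_ball x s.
Proof. by move=> rs; apply: sub_eucl_ball; rewrite eucl_distxx add0r. Qed.

Lemma eucl_dist_rat_approx x r : 0 < r ->
  exists q : d.-tuple rat, eucl_dist x (map_tuple ratr q) <= r.
Proof.
(* A coordinate error of [r / d.+1] suffices, as [d <= d.+1 ^ 2]; the divisor is nonzero even for
   [d = 0]. *)
move=> r0; have e0 : 0 < r / d.+1%:R by rewrite divr_gt0.
have H i : exists p : rat, tnth x i < ratr p < tnth x i + r / d.+1%:R.
  have /rat_in_itvoo[p] : tnth x i < tnth x i + r / d.+1%:R by rewrite ltrDl.
  by rewrite in_itv/=; exists p.
have [q Hq] := choice H; exists (mktuple q).
rewrite -[leRHS](ger0_norm (ltW r0)) -sqrtr_sqr; apply: ler_wsqrtr.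
apply: (@le_trans _ _ (\sum_(i < d) (r / d.+1%:R) ^+ 2)).
  apply: ler_sum => i _; rewrite tnth_map tnth_mktuple -sqrrN opprB.
  have /andP[h1 h2] := Hq i.
  by rewrite ler_pXn2r// ?nnegrE ?subr_ge0 ?(ltW e0) ?(ltW h1)// lerBlDl ltW.
rewrite sumr_const card_ord -[leLHS]mulr_natl expr_div_n mulrCA.
apply: ler_piMr; first exact: sqr_ge0.
rewrite ler_pdivrMr ?exprn_gt0// mul1r expr2 -natrM ler_nat.
exact: leq_trans (leqnSn d) (leq_pmulr _ _).
Qed.

End eucl_dist_theory.

Section spheres_null.
Context {R : realType}.

Lemma measurable_sphere {d : nat} (x : d.-tuple R) r :
  measurable [set y | eucl_dist y x = r].
Proof.
have me : measurable_fun setT (fun y => eucl_dist y x).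
  by apply: measurable_eucl_dist.
rewrite -[X in measurable X]setTI; exact: (me measurableT [set r]).
Qed.

(** By Fubini: once all coordinates but the first are fixed, the sphere meets the remaining line in
    at most two points. *)
Lemma lebesgue_tuple_sphere (d : nat) (x : d.-tuple R) r : (0 < d)%N ->
  lebesgue_tuple d [set y | eucl_dist y x = r] = 0%E.
Proof.
case: d x => [//|d] x _.
rewrite /= /cons_measure /pushforward.
set M := _ @^-1` _.
have mM : measurable M.
  rewrite -[X in measurable X]setTI.
  exact: (measurable_tuple_cons measurableT (measurable_sphere _ _)).
rewrite (@product_measure_unique _ _ _ _ _ _ _
  (lebesgue_measure \x^ lebesgue_tuple d)%E)//;
  last by move=> A B mA mB; exact: product_measure2E.
rewrite /product_measure2 /=; apply: integral0_eq => t _ /=.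
set c := \sum_(i < d) (tnth t i - tnth x (lift ord0 i)) ^+ 2.
have sub : ysection M t `<=`
    [set thead x + Num.sqrt (r ^+ 2 - c); thead x - Num.sqrt (r ^+ 2 - c)].
  move=> a; rewrite /ysection /= inE /M /= /tuple_cons /= => ar.
  have {}ar : (a - thead x) ^+ 2 = r ^+ 2 - c.
    rewrite -ar /eucl_dist sqr_sqrtr; last first.
      by apply: sumr_ge0 => i _; exact: sqr_ge0.
    rewrite big_ord_recl /= -[X in _ = X - _]addrC.
    under eq_bigr do rewrite tnthS.
    by rewrite addrAC subrr add0r.
  have : `|a - thead x| = Num.sqrt (r ^+ 2 - c) by rewrite -ar sqrtr_sqr.
  have [_ <-|_ <-] := ger0P (a - thead x).
    by left => /=; ring.
  by right => /=; ring.
apply/eqP; rewrite eq_le measure_ge0 andbT.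
have <- : lebesgue_measure [set thead x + Num.sqrt (r ^+ 2 - c);
    thead x - Num.sqrt (r ^+ 2 - c)] = 0%E.
  by apply: countable_lebesgue_measure0; apply: finite_set_countable.
apply: le_measure; rewrite ?inE//; first exact: measurable_ysection.
by apply: measurableU.
Qed.

End spheres_null.

(** * The mass of a ball as a function of its radius *)

Section ball_mass.
Context {R : realType} {d : nat}.
Variable mu : probability (d.-tuple R) R.
Implicit Types (x y z : d.-tuple R) (r s u : R).

Definition ball_mass x r : R := fine (mu (eucl_ball x r)).

Lemma ball_massE x r : mu (eucl_ball x r) = (ball_mass x r)%:E.
Proof. by rewrite fineK// fin_num_measure//; exact: measurable_eucl_ball. Qed.

Lemma ball_mass_ge0 x r : 0 <= ball_mass x r.
Proof. exact: fine_ge0. Qed.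

Lemma ball_mass_sub x z r s : eucl_ball x r `<=` eucl_ball z s ->
  ball_mass x r <= ball_mass z s.
Proof.
move=> xz; rewrite -lee_fin -!ball_massE.
by apply: le_measure; rewrite ?inE//; exact: measurable_eucl_ball.
Qed.

Lemma le_ball_mass x r s : r <= s -> ball_mass x r <= ball_mass x s.
Proof. by move=> rs; apply: ball_mass_sub; exact: le_eucl_ball. Qed.

Lemma measurable_ball_mass d' (S : measurableType d') (f : S -> d.-tuple R)
    (g : S -> R) : measurable_fun setT f -> measurable_fun setT g ->
  measurable_fun setT (fun w => ball_mass (f w) (g w)).
Proof.
move=> mf mg; apply: measurableT_comp; first exact: fine_measurable.
pose B := [set p : S * d.-tuple R | eucl_dist p.2 (f p.1) <= g p.1].
rewrite (_ : (fun _ => _) = mu \o xsection B); last first.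
  apply/funext => w /=; congr (mu _); apply/seteqP.
  by split => t /=; rewrite /xsection /= inE.
apply: measurable_fun_xsection; rewrite -[X in measurable X]setTI.
suff mb : measurable_fun [set: S * d.-tuple R]
    (fun p => eucl_dist p.2 (f p.1) <= g p.1).
  by apply: (mb measurableT [set true]).
apply: measurable_fun_ler; last exact: measurableT_comp.
by apply: measurable_eucl_dist => //; exact: measurableT_comp.
Qed.

Hypothesis sphere0 : forall x r, mu [set y | eucl_dist y x = r] = 0%E.

Lemma ball_mass0 x : ball_mass x 0 = 0.
Proof.
rewrite /ball_mass (_ : eucl_ball x 0 = [set y | eucl_dist y x = 0]).
  by rewrite sphere0.
apply/seteqP; split => y; rewrite /eucl_ball /=; last by move=> ->.
move=> y0.
by apply/eqP; rewrite eq_le y0 eucl_dist_ge0.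
Qed.

Lemma ball_mass_unbounded x u : u < 1 -> exists2 r, 0 <= r & u < ball_mass x r.
Proof.
move=> u1; pose F (n : nat) := eucl_ball x n%:R.
have mF n : measurable (F n) by exact: measurable_eucl_ball.
have UF : \bigcup_n F n = setT.
  apply/seteqP; split => // y _; exists (Num.truncn (eucl_dist y x)).+1 => //.
  by rewrite /F /eucl_ball /= ltW// truncnS_gt.
have : mu \o F @ \oo --> mu (\bigcup_n F n).
  apply: nondecreasing_cvg_mu => //; first by rewrite UF.
  by move=> m n mn; apply/subsetPset/le_eucl_ball; rewrite ler_nat.
rewrite UF probability_setT => cF; apply: contrapT => H.
suff : (1%:E <= u%:E)%E by rewrite lee_fin leNgt u1.
rewrite -(cvg_lim _ cF)//; apply: lime_le; first by apply/cvg_ex; eexists; exact: cF.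
apply: nearW => n /=; rewrite /F ball_massE lee_fin leNgt.
by apply/negP => un; apply: H; exists n%:R.
Qed.

(* Spheres being null, [r |-> ball_mass x r] is continuous; [r] below is the
   largest radius at which it takes the value [u]. *)
Lemma ball_mass_inverse x u : 0 <= u < 1 ->
  exists r, [/\ 0 <= r, ball_mass x r = u
    & forall s, (ball_mass x s <= u) = (s <= r)].
Proof.
move=> /andP[u0 u1]; pose S := [set s | ball_mass x s <= u].
have S0 : S 0 by rewrite /S /= ball_mass0.
have [b b0 ub] := ball_mass_unbounded x u1.
have Sb : ubound S b.
  move=> s Ss; rewrite leNgt; apply/negP => /ltW bs.
  by move: ub; rewrite ltNge (le_trans (le_ball_mass x bs) Ss).
have hS : has_sup S by split; [exists 0|exists b].
have supS0 : 0 <= sup S by apply: ub_le_sup => //; exists b.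
have below s : s < sup S -> ball_mass x s <= u.
  move=> /(sup_gt (ex_intro _ _ S0))[s' Ss' ss'].
  exact: le_trans (le_ball_mass x (ltW ss')) Ss'.
have above s : sup S < s -> u < ball_mass x s.
  rewrite !ltNge => /negP sS; apply/negP => Ss; apply: sS.
  by apply: ub_le_sup => //; exists b.
(* Left continuity: the closed ball is the union of the smaller concentric balls [F n] and of its
   boundary sphere, which is null. *)
have le_u : ball_mass x (sup S) <= u.
  pose F (n : nat) := eucl_ball x (sup S - n.+1%:R^-1).
  have mF n : measurable (F n) by exact: measurable_eucl_ball.
  have mUF : measurable (\bigcup_n F n) by exact: bigcup_measurable.
  have cF : mu \o F @ \oo --> mu (\bigcup_n F n).
    apply: nondecreasing_cvg_mu => //.
    move=> m n mn; apply/subsetPset/le_eucl_ball.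
    by rewrite lerD2l lerN2 lef_pV2 ?posrE// ler_nat.
  have UFu : (mu (\bigcup_n F n) <= u%:E)%E.
    rewrite -(cvg_lim _ cF)//; apply: lime_le; first by apply/cvg_ex; eexists; exact: cF.
    apply: nearW => n /=; rewrite /F ball_massE lee_fin; apply: below.
    by rewrite ltrBlDr ltrDl.
  rewrite -lee_fin -ball_massE.
  apply: le_trans UFu; rewrite -[leRHS]adde0 -(sphere0 x (sup S)).
  apply: le_trans (measureU2 _ _ _) => //; last exact: measurable_sphere.
  apply: le_measure; rewrite ?inE.
  - exact: measurable_eucl_ball.
  - by apply: measurableU => //; exact: measurable_sphere.
  - move=> y; rewrite /eucl_ball /= le_eqVlt => /predU1P[|yS]; first by right.
    left; have := yS; rewrite -subr_gt0 => /ltr_add_invr[n].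
    rewrite add0r => nS; exists n => //; rewrite /F /eucl_ball /=.
    by rewrite lerBrDr -lerBrDl ltW.
(* Right continuity: the closed ball is the intersection of the larger ones, and [mu] is finite. *)
have ge_u : u <= ball_mass x (sup S).
  pose F (n : nat) := eucl_ball x (sup S + n.+1%:R^-1).
  have mF n : measurable (F n) by exact: measurable_eucl_ball.
  have IF : \bigcap_n F n = eucl_ball x (sup S).
    apply/seteqP; split => y.
      move=> Fy; rewrite /eucl_ball /=; apply/ler_addgt0Pr => e e0.
      have /ltr_add_invr[n] := e0; rewrite add0r => ne.
      by rewrite (le_trans (Fy n I))// lerD2l ltW.
    by move=> yS n _; apply: (le_eucl_ball _ yS); rewrite lerDl.
  have cF : mu \o F @ \oo --> mu (\bigcap_n F n).
    apply: nonincreasing_cvg_mu => //.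
    - by rewrite -ge0_fin_numE// fin_num_measure.
    - by rewrite IF; exact: measurable_eucl_ball.
    - move=> m n mn; apply/subsetPset/le_eucl_ball.
      by rewrite lerD2l lef_pV2 ?posrE// ler_nat.
  rewrite -lee_fin -ball_massE -IF -(cvg_lim _ cF)//.
  apply: lime_ge; first by apply/cvg_ex; eexists; exact: cF.
  apply: nearW => n /=; rewrite /F ball_massE lee_fin ltW// above//.
  by rewrite ltrDl.
exists (sup S); split => //; first by apply/eqP; rewrite eq_le le_u ge_u.
move=> s; have [sS|Ss] := leP s (sup S).
  exact: le_trans (le_ball_mass x sS) le_u.
by apply/negP/negP; rewrite -ltNge above.
Qed.

End ball_mass.

(** * Support and doubling *)

Section support.
Context {R : realType} {d : nat}.
Variable mu : probability (d.-tuple R) R.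
Implicit Types (x y z : d.-tuple R) (r s u : R).

(** A point off the support has a null ball around it, hence lies in a null ball with rational
    centre and radius [1 / n.+1]; there are countably many of these. The measurable set [S] stands
    in for the support from here on. *)
Lemma measure_supp_full : exists S : set (d.-tuple R),
  [/\ measurable S, mu S = 1%E & S `<=` measure_supp mu].
Proof.
(* [B] enumerates, through pickling, the null balls with rational centre and radius [1 / n.+1];
   every other code gives [set0]. *)
pose B (k : nat) : set (d.-tuple R) :=
  if @choice.unpickle (d.-tuple rat * nat)%type k is Some (q, n) then
    let b := eucl_ball (map_tuple ratr q) (n.+1%:R^-1 : R) in
    if mu b == 0%E then b else set0
  else set0.
have mB k : measurable (B k).
  rewrite /B; case: choice.unpickle => [[q n]|]//.
  by case: ifP => // _; exact: measurable_eucl_ball.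
have B0 k : mu (B k) = 0%E.
  rewrite /B; case: choice.unpickle => [[q n]|]; rewrite ?measure0//=.
  by case: ifPn => [/eqP//|_]; rewrite measure0.
have mUB : measurable (\bigcup_k B k) by exact: bigcup_measurable.
exists (~` \bigcup_k B k); split.
- exact: measurableC.
- have nUB : mu.-negligible (\bigcup_k B k).
    by apply: negligible_bigcup => k; exists (B k); split; [exact: mB|exact: B0|].
  have UB0 := (negligibleP mu mUB).1 nUB.
  by rewrite probability_setC// [X in (_ - X)%E]UB0// sube0.
- move=> x xB r r0; rewrite lt_neqAle measure_ge0 andbT; apply/eqP => xr0.
  apply: xB.
  (* With [1 / n.+1 < r / 2], a rational ball that contains [x] lies inside the null ball of radius
     [r]. *)
  have /ltr_add_invr[n] : 0 < r / 2 by rewrite divr_gt0.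
  rewrite add0r => nr.
  have n0 : 0 < n.+1%:R^-1 :> R by [].
  have [q xq] := eucl_dist_rat_approx x n0.
  have qx0 : mu (eucl_ball (map_tuple ratr q) n.+1%:R^-1) = 0%E.
    apply/eqP; rewrite eq_le measure_ge0 andbT xr0.
    apply: le_measure; rewrite ?inE; try exact: measurable_eucl_ball.
    by apply: sub_eucl_ball; rewrite eucl_distC (splitr r) lerD ?(le_trans xq)// ltW.
  exists (choice.pickle (q, n)) => //; rewrite /B choice.pickleK /= qx0 eqxx.
  by rewrite /eucl_ball.
Qed.

End support.

Section doubling.
Context {R : realType} {d : nat}.
Variable mu : probability (d.-tuple R) R.
Implicit Types (x y z : d.-tuple R) (r s u : R).
Hypothesis sphere0 : forall x r, mu [set y | eucl_dist y x = r] = 0%E.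

Local Notation G := (ball_mass mu).

(** A set of full mass is not contained in a ball of radius [0], which has mass zero. *)
Lemma measure_supp_pair : exists x1 x2,
  [/\ measure_supp mu x1, measure_supp mu x2 & 0 < eucl_dist x1 x2].
Proof.
have [S [mS S1 Ssupp]] := measure_supp_full mu.
have [x1 Sx1] : exists x, S x.
  apply: contrapT => /forallNP S0; move: S1.
  rewrite (_ : S = set0) ?measure0; last by apply/seteqP; split => // x /S0.
  by move=> /eqP; rewrite lt_eqF.
have [x2 [Sx2 x21]] : exists x, S x /\ ~ eucl_dist x x1 <= 0.
  apply: contrapT => /forallNP H; have : S `<=` eucl_ball x1 0.
    by move=> x Sx; apply: contrapT => xx1; apply: (H x).
  move=> sub; have : (mu S <= mu (eucl_ball x1 0))%E.
    by apply: le_measure sub; rewrite ?inE//; exact: measurable_eucl_ball.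
  by rewrite S1 ball_massE ball_mass0// lee_fin ler10.
exists x1, x2; split; [exact: Ssupp|exact: Ssupp|].
by rewrite eucl_distC ltNge; exact/negP.
Qed.

(* Some fixed mass [c] lies far from any [z], on one of two balls around points
   of the support; a small ball around [z] does not cover that ball. *)
Lemma far_support_point : exists2 c, 0 < c & forall z s, G z s < c ->
  exists x, [/\ measure_supp mu x, s < eucl_dist x z & c <= G x (eucl_dist x z)].
Proof.
have [S [mS S1 Ssupp]] := measure_supp_full mu.
have [x1 [x2 [sx1 sx2 x12]]] := measure_supp_pair.
set D := eucl_dist x1 x2 in x12; pose rho := D / 8.
have rho0 : 0 < rho by rewrite divr_gt0.
have G1 : 0 < G x1 rho by rewrite -lte_fin -ball_massE; exact: sx1.
have G2 : 0 < G x2 rho by rewrite -lte_fin -ball_massE; exact: sx2.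
exists (Num.min (G x1 rho) (G x2 rho)); first by rewrite lt_min G1.
move=> z s; rewrite lt_min => /andP[z1 z2].
(* By the triangle inequality one of [x1], [x2] is at distance at least [D / 2 = 4 * rho] from
   [z]. *)
have [p [pfar pG pc]] : exists p, [/\ 4 * rho <= eucl_dist p z,
    G z s < G p rho & Num.min (G x1 rho) (G x2 rho) <= G p rho].
  have := eucl_dist_triangle z x1 x2; rewrite -/D (eucl_distC z) => tri.
  have [le1|lt1] := leP (4 * rho) (eucl_dist x1 z).
    by exists x1; split => //; rewrite ge_min lexx.
  exists x2; split => //; last by rewrite ge_min lexx orbT.
  by rewrite /rho in lt1 *; lra.
(* The ball around [p] is heavier than the one around [z], and [S] has full mass, so some point of
   [S] in the former lies outside the latter. *)
have [x [Sx xp xz]] : exists x, [/\ S x, eucl_dist x p <= rho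
    & ~ eucl_dist x z <= s].
  apply: contrapT => /forallNP H.
  have sub : S `&` eucl_ball p rho `<=` eucl_ball z s.
    by move=> x [Sx xp]; apply: contrapT => xz; apply: (H x).
  have : (mu (S `&` eucl_ball p rho) <= mu (eucl_ball z s))%E.
    apply: le_measure sub; rewrite ?inE; last exact: measurable_eucl_ball.
    by apply: measurableI => //; exact: measurable_eucl_ball.
  have SC0 : mu (~` S) = 0%E by rewrite probability_setC// S1 subee.
  have : (mu (eucl_ball p rho) <= mu (S `&` eucl_ball p rho))%E.
    rewrite -[leRHS]adde0 -SC0; apply: le_trans (measureU2 _ _ _); last 2 first.
    - by apply: measurableI => //; exact: measurable_eucl_ball.
    - exact: measurableC.
    apply: le_measure; rewrite ?inE; first exact: measurable_eucl_ball.
      apply: measurableU; last exact: measurableC.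
      by apply: measurableI => //; exact: measurable_eucl_ball.
    by move=> x px; have [|] := pselect (S x); [left|right].
  move=> h1 h2; have := le_trans h1 h2.
  by rewrite !ball_massE lee_fin leNgt pG.
have {}xz : s < eucl_dist x z by rewrite ltNge; exact/negP.
exists x; split => //; first exact: Ssupp.
(* The ball around [x] reaching to [z] has radius at least [4 * rho - rho], so it contains the ball
   of radius [rho] around [p], which stays within [2 * rho] of [x]. *)
apply: le_trans pc _; apply: ball_mass_sub; apply: sub_eucl_ball.
have := eucl_dist_triangle x p z; rewrite (eucl_distC p x); lra.
Qed.

Variables (beta cmax delta : R).
Hypothesis delta_gt0 : 0 < delta.
Hypothesis mu_balls : forall (r s : R) (x z : d.-tuple R),
  0 < r -> 0 < s -> measure_supp mu x -> measure_supp mu z ->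
  Num.max r s <= eucl_dist x z ->
  mu (eucl_ball x r) = mu (eucl_ball z s) -> (mu (eucl_ball z s) <= delta%:E)%E ->
  fine (mu (eucl_ball x r `&` eucl_ball z s)) / fine (mu (eucl_ball z s)) <= beta /\
  (mu (eucl_ball z (2 * s)) <= cmax%:E * mu (eucl_ball z s))%E.

(** [mu_balls] asks for a second ball of the same mass whose centre is at least both radii away.
    [far_support_point] provides its centre and [ball_mass_inverse] its radius. *)
Lemma small_ball_doubling : exists2 e, 0 < e & forall z s,
  measure_supp mu z -> 0 < s -> G z s <= e -> G z (2 * s) <= cmax * G z s.
Proof.
have [c c0 Hc] := far_support_point.
(* [delta] is the bound in [mu_balls], [2^-1] keeps the mass below [1] for [ball_mass_inverse], and
   [c / 2] makes [G z s] strictly less than [c]. *)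
exists (Num.min (Num.min delta 2^-1) (c / 2)).
  by rewrite !lt_min delta_gt0 invr_gt0 ltr0n divr_gt0.
move=> z s sz s0; rewrite !le_min => /andP[/andP[zd z1] zc].
have zltc : G z s < c by lra.
have [x [sx sxz cx]] := Hc z s zltc.
have Gz0 : 0 < G z s by rewrite -lte_fin -ball_massE; exact: sz.
have [r [r0 xr Hr]] : exists r, [/\ 0 <= r, G x r = G z s
    & forall s', (G x s' <= G z s) = (s' <= r)].
  by apply: ball_mass_inverse => //; rewrite ltW//=; lra.
have {r0}r0 : 0 < r.
  rewrite lt_neqAle r0 andbT; apply/eqP => r_eq0; move: xr.
  by rewrite -r_eq0 ball_mass0// => /eqP; rewrite lt_eqF.
have rxz : r < eucl_dist x z by rewrite ltNge -Hr -ltNge; lra.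
have [] := mu_balls r0 s0 sx sz _ _ _.
- by rewrite ge_max !ltW.
- by rewrite !ball_massE xr.
- by rewrite ball_massE lee_fin.
- by move=> _; rewrite !ball_massE -EFinM lee_fin.
Qed.

Lemma small_ball_doubling_iter m : exists e C, [/\ 0 < e, 0 < C & forall z s,
  measure_supp mu z -> 0 < s -> G z s <= e -> G z (2 ^+ m * s) <= C * G z s].
Proof.
have [e e0 He] := small_ball_doubling.
elim: m => [|m [e' [C [e'0 C0 IH]]]].
  by exists 1, 1; split => // z s _ _ _; rewrite expr0 !mul1r.
(* The maximum with [1] gives a positive factor whatever the sign of [cmax]. The bound [e / C] below
   keeps the ball of radius [2 ^+ m * s] light enough for one more doubling. *)
pose c := Num.max cmax 1; have c0 : 0 < c by rewrite lt_max ltr01 orbT.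
exists (Num.min e' (e / C)), (c * C); split.
- by rewrite lt_min e'0 divr_gt0.
- exact: mulr_gt0.
move=> z s sz s0; rewrite le_min => /andP[/(IH _ _ sz s0) zm ze].
rewrite exprS -mulrA; apply: (@le_trans _ _ (c * G z (2 ^+ m * s))); last first.
  by rewrite -mulrA ler_pM2l.
apply: (@le_trans _ _ (cmax * G z (2 ^+ m * s))).
  apply: He => //; first by rewrite mulr_gt0// exprn_gt0.
  by rewrite (le_trans zm)// mulrC -ler_pdivlMr.
by rewrite ler_wpM2r ?ball_mass_ge0// le_max lexx.
Qed.

End doubling.

(** * Resampling coordinates of a product measure *)

Section tuple_boxes.
Context d (T : measurableType d) (R : realType) (n : nat).

Definition box (A : 'I_n -> set T) : set (n.-tuple T) :=
  [set z | forall i, A i (tnth z i)].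

Lemma measurable_box (A : 'I_n -> set T) :
  (forall i, measurable (A i)) -> measurable (box A).
Proof.
move=> mA.
have -> : box A = \bigcap_(i in [set: 'I_n]) ((@tnth n T ^~ i) @^-1` A i).
  by apply/seteqP; split=> z /= Az; [move=> i _; exact: Az | move=> i; exact: (Az i I)].
apply: fin_bigcap_measurable => // i _.
by rewrite -[X in measurable X]setTI; exact: measurable_tnth.
Qed.

(** Boxes form a pi-system that contains the whole space and generates the product sigma-algebra. *)
Lemma tuple_measure_unique (m1 m2 : {measure set (n.-tuple T) -> \bar R}) :
  (m1 setT < +oo)%E ->
  (forall A : 'I_n -> set T, (forall i, measurable (A i)) ->
    m1 (box A) = m2 (box A)) ->
  forall B, measurable B -> m1 B = m2 B.
Proof.
move=> m1T m12 B mB.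
pose G := [set C | exists2 A : 'I_n -> set T,
  (forall i, measurable (A i)) & C = box A].
have boxT : box (fun=> setT) = setT by apply/seteqP; split.
have GT : G setT by exists (fun=> setT).
apply: (measure_unique G (fun=> setT)) => //.
- apply/seteqP; split.
    apply: smallest_sub; first exact: smallest_sigma_algebra.
    rewrite -bigcup_seq => _ [i _ [A mA <-]]; rewrite setTI.
    apply: sub_sigma_algebra; exists (fun j => if j == i then A else setT).
      by move=> j; case: ifP.
    apply/seteqP; split=> z /=.
      by move=> Az j; case: eqP => // ->.
    by move=> /(_ i); rewrite eqxx.
  apply: smallest_sub; first exact: sigma_algebra_measurable.
  by move=> _ [A mA ->]; exact: measurable_box.
- move=> _ _ [A mA ->] [A' mA' ->]; exists (fun i => A i `&` A' i).
    by move=> i; exact: measurableI.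
  apply/seteqP; split => z /=; first by move=> [Az A'z] i; split.
  by move=> AA'z; split => i; have [] := AA'z i.
- by rewrite bigcup_const.
- by move=> _ [A mA ->]; exact: m12.
Qed.

End tuple_boxes.

Section resampling.
Context d (T : measurableType d) (R : realType) (n : nat).
Variables (mu : probability T R) (nu : probability (n.-tuple T) R).
Hypothesis nu_box : forall A : 'I_n -> set T, (forall i, measurable (A i)) ->
  nu (box A) = (\prod_(i < n) mu (A i))%E.

Definition set_tnth (z : n.-tuple T) (i : 'I_n) (x : T) : n.-tuple T :=
  [tuple if j == i then x else tnth z j | j < n].

Lemma tnth_set_tnth z i x j :
  tnth (set_tnth z i x) j = if j == i then x else tnth z j.
Proof. by rewrite tnth_mktuple. Qed.

Lemma set_tnth_tnth z i x y : set_tnth (set_tnth z i x) i y = set_tnth z i y.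
Proof.
by apply: eq_from_tnth => j; rewrite !tnth_set_tnth; case: eqP.
Qed.

Lemma set_tnthC z i j x y : i != j ->
  set_tnth (set_tnth z i x) j y = set_tnth (set_tnth z j y) i x.
Proof.
move=> ij; apply: eq_from_tnth => k; rewrite !tnth_set_tnth.
by have [->|//] := eqVneq k j; rewrite eq_sym (negbTE ij).
Qed.

Lemma measurable_set_tnth i :
  measurable_fun setT (fun p : n.-tuple T * T => set_tnth p.1 i p.2).
Proof.
apply/measurable_fun_tnthP => j.
rewrite (_ : _ \o _ = fun p => if j == i then p.2 else tnth p.1 j); last first.
  by apply/funext => p /=; rewrite tnth_set_tnth.
case: (j == i); first exact: measurable_snd.
exact: (measurableT_comp (measurable_tnth j) measurable_fst).
Qed.

(** Replacing coordinate [i] by an independent draw from [mu] changes the mass of no box, hence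
    preserves the law [nu]; Tonelli's theorem then gives the iterated integral. *)
Lemma resample i (F : n.-tuple T -> \bar R) :
  measurable_fun [set: n.-tuple T] F -> (forall z, 0 <= F z)%E ->
  (\int[nu]_z F z = \int[nu]_z \int[mu]_x F (set_tnth z i x))%E.
Proof.
move=> mF F0.
pose phi := fun p : n.-tuple T * T => set_tnth p.1 i p.2.
have mphi : measurable_fun setT phi := measurable_set_tnth i.
pose pack := isMeasurableFun.Build _ _ _ _ _ mphi.
pose phi' : {mfun (n.-tuple T * T)%type >-> n.-tuple T} := HB.pack phi pack.
pose m' := distribution (nu \x mu)%E phi'.
transitivity (\int[m']_z F z)%E.
  apply: eq_measure_integral => B mB _.
  apply: tuple_measure_unique => //; first by apply: le_lt_trans (ltry 1); exact: probability_le1.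
  move=> A mA; apply: etrans (nu_box mA) _.
  rewrite /m' /distribution /pushforward /=.
  rewrite (_ : _ @^-1` _ =
    box (fun j => if j == i then setT else A j) `*` A i); last first.
    apply/seteqP; split=> -[z x] /= => [H|[H Ai] j].
      split; last by have := H i; rewrite tnth_set_tnth eqxx.
      by move=> j; have := H j; rewrite tnth_set_tnth; case: ifP.
    by have := H j; rewrite tnth_set_tnth; case: eqP => // ->.
  have mA' j : measurable (if j == i then setT else A j) by case: ifP.
  rewrite product_measure1E//; last exact: measurable_box.
  apply/esym; apply: etrans (congr1 (fun u => u * mu (A i))%E (nu_box mA')) _.
  rewrite [in RHS](bigD1 i)//= (bigD1 i)//= eqxx probability_setT mul1e muleC.
  congr (_ * _)%E; by apply: eq_bigr => j /negbTE ->.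
rewrite ge0_integral_distribution// fubini_tonelli1//=.
exact: measurableT_comp.
Qed.

Definition free_of U (F : n.-tuple T -> U) (i : 'I_n) :=
  forall z x, F (set_tnth z i x) = F z.

Lemma free_of_all U (F : n.-tuple T -> U) z w :
  (forall i, free_of F i) -> F z = F w.
Proof.
move=> Ff.
suff H (s : seq 'I_n) : F [tuple if j \in s then tnth w j else tnth z j | j < n] = F z.
  rewrite -(H (enum 'I_n)); congr F; apply: eq_from_tnth => j.
  by rewrite tnth_mktuple mem_enum inE.
elim: s => [|i s <-].
  by congr F; apply: eq_from_tnth => j; rewrite tnth_mktuple.
rewrite -[RHS](Ff i _ (tnth w i)); congr F.
apply: eq_from_tnth => j; rewrite tnth_set_tnth !tnth_mktuple inE.
by have [->|] := eqVneq.
Qed.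

(** [F'] is [F] with the coordinates in [s] integrated out one after the other: a concrete
    conditional expectation given the remaining ones. *)
Lemma integral_free_of (s : seq 'I_n) (F : n.-tuple T -> \bar R) :
  measurable_fun [set: n.-tuple T] F -> (forall z, 0 <= F z)%E ->
  exists F' : n.-tuple T -> \bar R, [/\ measurable_fun [set: n.-tuple T] F',
    (forall z, 0 <= F' z)%E,
    forall i, (i \in s \/ free_of F i) -> free_of F' i &
    forall G : n.-tuple T -> \bar R, measurable_fun [set: n.-tuple T] G ->
      (forall z, 0 <= G z)%E -> (forall i, i \in s -> free_of G i) ->
      (\int[nu]_z (F z * G z) = \int[nu]_z (F' z * G z))%E].
Proof.
move=> mF F0; elim: s => [|i s [F' [mF' F'0 F'f F'E]]].
  by exists F; split => // i [].
have mF'i : measurable_fun setT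
    (fun p : n.-tuple T * T => F' (set_tnth p.1 i p.2)).
  exact: (measurableT_comp mF' (measurable_set_tnth i)).
exists (fun z => \int[mu]_x F' (set_tnth z i x))%E; split.
- exact: (measurable_fun_fubini_tonelli_F _ mF'i).
- by move=> z; apply: integral_ge0.
- move=> j /= js z x; have [<-|ji] := eqVneq i j.
    by apply: eq_integral => y _; rewrite set_tnth_tnth.
  have {}js : j \in s \/ free_of F j.
    by case: js => [|?]; [rewrite inE eq_sym (negbTE ji)/=; left|right].
  apply: eq_integral => y _.
  by rewrite set_tnthC 1?eq_sym// F'f.
- move=> G mG G0 Gf; rewrite F'E//; last first.
    by move=> j js; apply: Gf; rewrite inE js orbT.
  rewrite (resample i); [|exact: emeasurable_funM|by move=> z; exact: mule_ge0].
  apply: eq_integral => z _.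
  under eq_integral do rewrite (Gf i (mem_head _ _)) muleC.
  rewrite ge0_integralZl//; first by rewrite muleC.
  exact: (measurableT_comp mF'i (measurable_pair1 z)).
Qed.

(** Functions of disjoint blocks of coordinates are independent: integrating out [A] turns [F] into
    a constant, which is its mean. *)
Lemma integralM_free_of (A : {set 'I_n}) (F G : n.-tuple T -> \bar R) :
  measurable_fun [set: n.-tuple T] F -> (forall z, 0 <= F z)%E ->
  measurable_fun [set: n.-tuple T] G -> (forall z, 0 <= G z)%E ->
  (forall i, i \notin A -> free_of F i) ->
  (forall i, i \in A -> free_of G i) ->
  (\int[nu]_z (F z * G z) = \int[nu]_z F z * \int[nu]_z G z)%E.
Proof.
move=> mF F0 mG G0 FA GA.
have [F' [mF' F'0 F'f F'E]] := integral_free_of (enum A) mF F0.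
have {}F'f i : free_of F' i.
  apply: F'f; rewrite mem_enum.
  by have [iA|iA] := boolP (i \in A); [left|right; exact: FA].
have [z0 _] : exists z0 : n.-tuple T, setT z0.
  apply: contrapT => /forallNP H; have := @probability_setT _ _ _ nu.
  rewrite (_ : setT = set0) ?measure0; last by apply/seteqP; split=> z // /H.
  by move/eqP; rewrite lt_eqF// lte01.
have F'c z : F' z = F' z0 by exact: free_of_all.
have intF : (\int[nu]_z F z = F' z0)%E.
  under eq_integral do rewrite -[F _]mule1.
  rewrite (F'E (cst 1%E))//.
  under eq_integral do rewrite F'c mule1.
  by rewrite integral_cst// [X in (_ * X)%E]probability_setT mule1.
rewrite intF F'E//; last by move=> i; rewrite mem_enum; exact: GA.
under eq_integral do rewrite F'c.
by rewrite ge0_integralZl.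
Qed.

Lemma measurable_mass_xsection (D : set (n.-tuple T * T)) : measurable D ->
  measurable_fun setT (fun z => fine (mu (xsection D z))).
Proof.
move=> mD; apply: measurableT_comp; first exact: fine_measurable.
exact: measurable_fun_xsection.
Qed.

Lemma measurable_indic_xsection (D : set (n.-tuple T * T)) i : measurable D ->
  measurable_fun setT (fun z => \1_(xsection D z) (tnth z i) : R).
Proof.
move=> mD.
rewrite (_ : (fun _ => _) = \1_D \o (fun z => (z, tnth z i))); last first.
  by apply/funext => z /=; rewrite !indicE mem_xsection.
apply: measurableT_comp; first exact: measurable_indic.
by apply: measurable_fun_pair => //; exact: measurable_tnth.
Qed.

(** Given the other coordinates, the points indexed by [s] are independent and each falls in the
    section with probability equal to its mass. They are integrated out one at a time, [h] absorbing
    the factors already obtained. *)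
Lemma integral_prod_xsection (s : seq 'I_n) (D : set (n.-tuple T * T))
    (h : n.-tuple T -> R) :
  uniq s -> measurable D -> measurable_fun [set: n.-tuple T] h ->
  (forall z, 0 <= h z) ->
  (forall i, i \in s -> free_of h i) ->
  (forall i, i \in s -> free_of (xsection D) i) ->
  (\int[nu]_z (h z * \prod_(i <- s) \1_(xsection D z) (tnth z i))%:E =
   \int[nu]_z (h z * fine (mu (xsection D z)) ^+ size s)%:E)%E.
Proof.
move=> + mD; elim: s h => [|i s IH] h /=.
  by move=> _ mh h0 _ _; apply: eq_integral => z _; rewrite big_nil expr0.
move=> /andP[is_ us] mh h0 hf Df.
have mh' : measurable_fun [set: n.-tuple T]
    (fun z => h z * fine (mu (xsection D z))).
  by apply: measurable_funM => //; exact: measurable_mass_xsection.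
have mprod : measurable_fun [set: n.-tuple T]
    (fun z => \prod_(j <- s) (\1_(xsection D z) (tnth z j) : R)).
  by apply: measurable_prod => j _; exact: measurable_indic_xsection.
rewrite (resample i); last 2 first.
- apply/measurable_EFinP; apply: measurable_funM => //.
  by apply: measurable_prod => j _; exact: measurable_indic_xsection.
- by move=> z; rewrite lee_fin mulr_ge0// prodr_ge0.
transitivity (\int[nu]_z (h z * fine (mu (xsection D z)) *
   \prod_(j <- s) \1_(xsection D z) (tnth z j))%:E)%E; last first.
  rewrite IH//.
  - by apply: eq_integral => z _; rewrite exprS mulrA.
  - by move=> z; rewrite mulr_ge0// fine_ge0.
  - move=> j js z x; have js' : j \in i :: s by rewrite inE js orbT.
    by rewrite hf// Df.
  - by move=> j js; apply: Df; rewrite inE js orbT.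
apply: eq_integral => z _.
have mDz : measurable (xsection D z) by exact: measurable_xsection.
have is1 : i \in i :: s by rewrite mem_head.
transitivity (\int[mu]_x ((h z * \prod_(j <- s) \1_(xsection D z) (tnth z j))%:E
  * (\1_(xsection D z) x)%:E))%E.
  apply: eq_integral => x _; rewrite -EFinM big_cons hf// Df// tnth_set_tnth eqxx.
  congr (_%:E); rewrite mulrCA mulrC; congr (_ * _ * _); apply: eq_big_seq => j js.
  by rewrite tnth_set_tnth; case: eqP => // ji; move: is_; rewrite -ji js.
rewrite ge0_integralZl//; last 2 first.
  - by apply/measurable_EFinP; exact: measurable_indic.
  - by rewrite lee_fin mulr_ge0// prodr_ge0.
rewrite integral_indic// setIT -[X in (_ * X)%E]fineK ?fin_num_measure// -EFinM.
by congr (_%:E); rewrite mulrAC.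
Qed.

End resampling.

(** * Clusters of cells *)

Section measurable_quantifiers.
Context d (T : measurableType d).

Lemma measurable_forall (I : finType) (P : I -> T -> Prop) :
  (forall i, measurable [set x | P i x]) ->
  measurable [set x | forall i, P i x].
Proof.
move=> mP.
rewrite (_ : [set _ | _] = \bigcap_(i in [set: I]) [set x | P i x]).
  by apply: fin_bigcap_measurable.
by apply/seteqP; split => x /= Px; [move=> i _; exact: Px|move=> i; exact: Px].
Qed.

Lemma measurable_exists (I : finType) (P : I -> T -> Prop) :
  (forall i, measurable [set x | P i x]) ->
  measurable [set x | exists i, P i x].
Proof.
move=> mP.
rewrite (_ : [set _ | _] = \bigcup_(i in [set: I]) [set x | P i x]).
  by apply: fin_bigcup_measurable.
by apply/seteqP; split => x /= [i]; [exists i|move=> _; exists i].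
Qed.

Lemma measurable_imply (b : bool) (P : T -> Prop) :
  measurable [set x | P x] -> measurable [set x | b -> P x].
Proof.
case: b => mP; last by rewrite (_ : [set _ | _] = setT)//; apply/seteqP; split.
by rewrite (_ : [set _ | _] = [set x | P x])//; apply/seteqP; split => x /=; auto.
Qed.

Lemma measurable_andb (b : bool) (P : T -> Prop) :
  measurable [set x | P x] -> measurable [set x | b /\ P x].
Proof.
case: b => mP; last by rewrite (_ : [set _ | _] = set0)//; apply/seteqP; split => x // [].
rewrite (_ : [set _ | _] = [set x | P x])//.
by apply/seteqP; split => x /=; [case|].
Qed.

End measurable_quantifiers.

Section clusters.
Context {R : realType} {d : nat}.
Variable mu : probability (d.-tuple R) R.
Hypothesis sphere0 : forall x r, mu [set y | eucl_dist y x = r] = 0%E.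
Variable t : R.
Hypothesis t01 : 0 < t < 1.

(* With [r] the largest radius such that [ball_mass mu x r = t], this is the
   ball of radius [rho * r] around [x]. *)
Definition dilated_cell (rho : R) (x : d.-tuple R) : set (d.-tuple R) :=
  [set y | ball_mass mu x (eucl_dist y x / rho) <= t].

(** The radius comes from a choice, without any measurability in [x]. This is why [dilated_cell]
    compares ball masses, which are jointly measurable in the centre and the point. *)
Lemma cell_radius : exists rad : d.-tuple R -> R, forall x,
  [/\ 0 < rad x, ball_mass mu x (rad x) = t
    & forall rho, 0 < rho -> dilated_cell rho x = eucl_ball x (rho * rad x)].
Proof.
have t0 : 0 <= t < 1 by case/andP: t01 => /ltW ->.
have H x := ball_mass_inverse sphere0 x t0.
have [rad Hrad] := choice H; exists rad => x.
have [r0 rt Hr] := Hrad x; split => //.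
  rewrite lt_neqAle r0 andbT; apply/eqP => r_eq0; move: rt t01.
  by rewrite -r_eq0 ball_mass0// => <-; rewrite ltxx.
move=> rho rho0; apply/seteqP; split => y; rewrite /dilated_cell /eucl_ball /=.
  by rewrite Hr ler_pdivrMr// mulrC.
by rewrite Hr ler_pdivrMr// mulrC.
Qed.

Lemma measurable_dilated_cell_rel rho d' (S : measurableType d')
    (f g : S -> d.-tuple R) : measurable_fun setT f -> measurable_fun setT g ->
  measurable [set w | dilated_cell rho (f w) (g w)].
Proof.
move=> mf mg; rewrite -[X in measurable X]setTI.
suff mb : measurable_fun [set: S]
    (fun w => ball_mass mu (f w) (eucl_dist (g w) (f w) / rho) <= t).
  exact: (mb measurableT [set true]).
apply: measurable_fun_ler => //; apply: measurable_ball_mass => //.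
by apply: measurable_funM => //; exact: measurable_eucl_dist.
Qed.

Lemma measurable_dilated_cell rho x : measurable (dilated_cell rho x).
Proof. exact: (@measurable_dilated_cell_rel rho _ _ (fun=> x) id). Qed.

Lemma mass_dilated_cell1 x : mu (dilated_cell 1 x) = t%:E.
Proof.
have [rad Hrad] := cell_radius; have [_ rt ->//] := Hrad x.
by rewrite mul1r ball_massE rt.
Qed.

Variable n : nat.
Implicit Types (z : n.-tuple (d.-tuple R)) (i j : 'I_n) (A V : {set 'I_n}).

Definition cells A z : set (d.-tuple R) :=
  [set x | exists i, i \in A /\ dilated_cell 1 (tnth z i) x].

(** [A] is the component of [i0] in the graph that joins indices of [V] whose cells meet, and [c] is
    its index with the largest cell. A simple path from [c] inside [A] has fewer than [K] edges,
    each spanning at most twice the radius at [c]. *)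
Lemma exists_cluster (K : nat) V i0 z : i0 \in V -> (#|V| <= K)%N ->
  exists A c, [/\ A \subset V, i0 \in A, c \in A,
    forall j, j \in A -> dilated_cell (2 * K%:R) (tnth z c) (tnth z j) &
    cells A z `&` cells (V :\: A) z = set0].
Proof.
move=> i0V VK; have [rad Hrad] := cell_radius.
have K0 : (0 < K)%N by rewrite (leq_trans _ VK)// card_gt0; apply/set0Pn; exists i0.
pose x i := tnth z i.
pose e i j := [&& i \in V, j \in V &
  `[< dilated_cell 1 (x i) `&` dilated_cell 1 (x j) !=set0 >]].
have esym : symmetric e.
  by move=> i j; rewrite /e setIC andbCA.
have csym : connect_sym e by exact: sym_connect_sym.
have edist i j : e i j -> eucl_dist (x j) (x i) <= rad (x i) + rad (x j).
  move=> /and3P[_ _ /asboolP[y []]].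
  have [_ _ ->//] := Hrad (x i); have [_ _ ->//] := Hrad (x j).
  rewrite !mul1r /eucl_ball /= => yi yj.
  apply: le_trans (eucl_dist_triangle y _ _) _; rewrite addrC lerD//.
  by rewrite eucl_distC.
pose A := finset (connect e i0).
have AV : A \subset V.
  apply/fintype.subsetP => j; rewrite inE => /connectP[p + ->].
  case/lastP: p => [//|p k]; rewrite rcons_path last_rcons => /andP[_].
  by case/and3P.
have i0A : i0 \in A by rewrite inE connect0.
have [c cA cmax] : exists2 c, c \in A & forall j, j \in A -> rad (x j) <= rad (x c).
  have := @arg_maxP _ _ _ i0 (mem A) (fun j => rad (x j)) i0A.
  by case=> c cA cm; exists c => // j /cm.
exists A, c; split => //.
- move=> j jA; have : connect e c j.
    by move: cA jA; rewrite !inE csym => /connect_trans; apply.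
  move=> /connectP[p /shortenP[q cq uq _] ->{p}].
  have qA k : k \in c :: q -> k \in A.
    move=> /(path_connect cq) ck; move: cA; rewrite !inE => ic.
    exact: connect_trans ic ck.
  have dist_last : eucl_dist (x (last c q)) (x c) <= (size q)%:R * (2 * rad (x c)).
    have : forall k, k \in c :: q -> rad (x k) <= rad (x c).
      by move=> k /qA; exact: cmax.
    move: (rad (x c)) => M; elim: q c cq {uq qA cA cmax} => [|k q IH] c /=.
      by rewrite eucl_distxx mul0r.
    move=> /andP[ck kq] HM; have [Hc Hk] : rad (x c) <= M /\ rad (x k) <= M.
      by split; apply: HM; rewrite !inE eqxx ?orbT.
    apply: le_trans (eucl_dist_triangle (x k) _ _) _.
    have h1 := edist _ _ ck.
    have h2 := IH k kq (fun j jq => HM j (@mem_behead _ (c :: k :: q) _ jq)).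
    by rewrite -natr1 mulrDl mul1r lerD// mulr2n mulrDl !mul1r; lra.
  have qK : (size q < K)%N.
    apply: leq_trans VK; apply: leq_trans (subset_leq_card AV).
    rewrite [#|A|]cardE; apply: (@uniq_leq_size _ (c :: q)) => // k /qA.
    by rewrite mem_enum.
  have [r0 _ ->] := Hrad (x c); last by rewrite mulr_gt0// ltr0n.
  rewrite /eucl_ball /=; apply: le_trans dist_last _.
  rewrite [2 * K%:R]mulrC -mulrA; apply: ler_wpM2r; last by rewrite ler_nat ltnW.
  by rewrite mulr_ge0// ltW.
- apply/seteqP; split => // y [[i [iA yi]] [j [+ yj]]].
  rewrite inE => /andP[/negP jA jV]; apply: jA.
  have iV : i \in V by move/fintype.subsetP : AV; apply.
  move: iA; rewrite !inE => i0i; apply: connect_trans i0i _; apply: connect1.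
  by apply/and3P; split => //; apply/asboolP; exists y.
Qed.

End clusters.

(** * Splitting off a cluster, and bounds for its contribution *)

Section cluster_integrals.
Context {R : realType} {d : nat}.
Variable mu : probability (d.-tuple R) R.
Hypothesis sphere0 : forall x r, mu [set y | eucl_dist y x = r] = 0%E.
Variable t : R.
Hypothesis t01 : 0 < t < 1.
Variable S : set (d.-tuple R).
Hypothesis mS : measurable S.
Variable n : nat.
Implicit Types (z : n.-tuple (d.-tuple R)) (i j : 'I_n) (A V : {set 'I_n}).

Local Notation cells := (cells mu t).

(** Membership in [S] is included so that estimates valid on the support apply to these points; [S]
    will be a subset of the support with full mass. *)
Definition separated A : set (n.-tuple (d.-tuple R)) :=
  [set z | forall i, i \in A -> S (tnth z i) /\
     forall j, (j \in A) && (j != i) -> ~ dilated_cell mu t 1 (tnth z i) (tnth z j)].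

Definition cells_mass A z : R := fine (mu (cells A z)).

(* Conditionally on the points indexed by [A], the chance that these are
   separated and that [N] further points all avoid their cells. *)
Definition avoidance (N : nat) A z : R :=
  \1_(separated A) z * (1 - cells_mass A z) ^+ N.

Definition clustered (K : nat) A : set (n.-tuple (d.-tuple R)) :=
  [set z | exists c, c \in A /\
     forall j, j \in A -> dilated_cell mu t (2 * K%:R) (tnth z c) (tnth z j)].

Definition cluster_avoidance (K N : nat) A z : R :=
  \1_(clustered K A) z * avoidance N A z.

Lemma measurable_cells_rel A :
  measurable [set p : n.-tuple (d.-tuple R) * d.-tuple R | cells A p.1 p.2].
Proof.
apply: measurable_exists => i; apply: measurable_andb.
apply: measurable_dilated_cell_rel; last exact: measurable_snd.
exact: (measurableT_comp (measurable_tnth i) measurable_fst).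
Qed.

Lemma xsection_cells_rel A z :
  xsection [set p : n.-tuple (d.-tuple R) * d.-tuple R | cells A p.1 p.2] z =
  cells A z.
Proof. by apply/seteqP; split => x; rewrite /xsection /= inE. Qed.

Lemma measurable_cells A z : measurable (cells A z).
Proof.
by rewrite -xsection_cells_rel; apply: measurable_xsection; exact: measurable_cells_rel.
Qed.

Lemma measurable_cells_mass A : measurable_fun setT (cells_mass A).
Proof.
rewrite (_ : cells_mass A = fun z => fine (mu (xsection
  [set p : n.-tuple (d.-tuple R) * d.-tuple R | cells A p.1 p.2] z))).
  apply: measurable_mass_xsection; exact: measurable_cells_rel.
by apply/funext => z; rewrite xsection_cells_rel.
Qed.

Lemma cells_massE A z : mu (cells A z) = (cells_mass A z)%:E.
Proof. by rewrite /cells_mass fineK// fin_num_measure//; exact: measurable_cells. Qed.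

Lemma cells_mass01 A z : 0 <= 1 - cells_mass A z <= 1.
Proof.
have h : cells_mass A z <= 1.
  by rewrite -lee_fin -cells_massE probability_le1//; exact: measurable_cells.
have h0 : 0 <= cells_mass A z by exact: fine_ge0.
by apply/andP; split; lra.
Qed.

Lemma cells_massU A V z : A \subset V -> cells A z `&` cells (V :\: A) z = set0 ->
  cells_mass V z = cells_mass A z + cells_mass (V :\: A) z.
Proof.
move=> AV disj; apply: EFin_inj; rewrite EFinD -!cells_massE -measureU//; last 2 first.
- exact: measurable_cells.
- exact: measurable_cells.
congr (mu _); apply/seteqP; split => [y [i [iV yi]]|y].
  have [iA|iA] := boolP (i \in A); first by left; exists i.
  have iVA : i \in V :\: A by rewrite inE iA.
  by right; exists i.
move=> [[i [iA yi]]|[i [iVA yi]]]; exists i; split => //.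
  exact: (fintype.subsetP AV i iA).
by move: iVA; rewrite inE => /andP[].
Qed.

Lemma measurable_separated A : measurable (separated A).
Proof.
apply: measurable_forall => i; apply: measurable_imply.
apply: measurableI.
  rewrite -[X in measurable X]setTI; exact: (measurable_tnth i measurableT mS).
apply: measurable_forall => j; apply: measurable_imply; apply: measurableC.
by apply: measurable_dilated_cell_rel; exact: measurable_tnth.
Qed.

Lemma measurable_clustered K A : measurable (clustered K A).
Proof.
apply: measurable_exists => c; apply: measurable_andb.
apply: measurable_forall => j; apply: measurable_imply.
by apply: measurable_dilated_cell_rel; exact: measurable_tnth.
Qed.

Lemma measurable_avoidance N A : measurable_fun setT (avoidance N A).
Proof.
apply: measurable_funM; first by apply: measurable_indic; exact: measurable_separated.
by apply: measurable_funX; apply: measurable_funB => //; exact: measurable_cells_mass.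
Qed.

Lemma measurable_cluster_avoidance K N A :
  measurable_fun setT (cluster_avoidance K N A).
Proof.
apply: measurable_funM; last exact: measurable_avoidance.
by apply: measurable_indic; exact: measurable_clustered.
Qed.

Lemma avoidance_ge0 N A z : 0 <= avoidance N A z.
Proof. by have /andP[? _] := cells_mass01 A z; rewrite mulr_ge0// exprn_ge0. Qed.

Lemma cluster_avoidance_ge0 K N A z : 0 <= cluster_avoidance K N A z.
Proof. by rewrite mulr_ge0// avoidance_ge0. Qed.

Lemma tnth_set_tnth_notin A i j z x : i \notin A -> j \in A ->
  tnth (set_tnth z i x) j = tnth z j.
Proof. by move=> iA jA; rewrite tnth_set_tnth; case: eqP jA iA => // -> ->. Qed.

Lemma cells_free A i : i \notin A -> free_of (cells A) i.
Proof.
move=> iA z x; apply/seteqP; split => y [j [jA p]]; exists j; split => //.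
  by move: p; rewrite (tnth_set_tnth_notin _ _ iA).
by rewrite (tnth_set_tnth_notin _ _ iA).
Qed.

Lemma separated_free A i z x : i \notin A ->
  separated A (set_tnth z i x) <-> separated A z.
Proof.
move=> iA; split => sz j jA; have [Sj Hj] := sz j jA; split.
- by move: Sj; rewrite (tnth_set_tnth_notin _ _ iA).
- move=> k /[dup] /andP[kA _] /Hj.
  by rewrite !(tnth_set_tnth_notin _ _ iA).
- by rewrite (tnth_set_tnth_notin _ _ iA).
- move=> k /[dup] /andP[kA _] /Hj.
  by rewrite !(tnth_set_tnth_notin _ _ iA).
Qed.

Lemma clustered_free K A i z x : i \notin A ->
  clustered K A (set_tnth z i x) <-> clustered K A z.
Proof.
move=> iA; split => -[c [cA Hc]]; exists c; split => // j jA; have := Hc j jA;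
by rewrite !(tnth_set_tnth_notin _ _ iA).
Qed.

Lemma avoidance_free N A i : i \notin A -> free_of (avoidance N A) i.
Proof.
move=> iA z x; rewrite /avoidance /cells_mass cells_free//; congr (_ * _).
rewrite !indicE; congr (_ : bool)%:R; apply/idP/idP; rewrite !inE => H;
by apply/(separated_free z x iA).
Qed.

Lemma cluster_avoidance_free K N A i :
  i \notin A -> free_of (cluster_avoidance K N A) i.
Proof.
move=> iA z x; rewrite /cluster_avoidance avoidance_free//; congr (_ * _).
rewrite !indicE; congr (_ : bool)%:R; apply/idP/idP; rewrite !inE => H;
by apply/(clustered_free K z x iA).
Qed.

Lemma separatedS A V z : A \subset V -> separated V z -> separated A z.
Proof.
move=> /fintype.subsetP AV sz i iA; have [Si Hi] := sz i (AV _ iA); split => // j.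
by move=> /andP[jA ji]; apply: Hi; rewrite AV.
Qed.

(** The term of the actual cluster of [i0] already dominates. Its cells are disjoint from the
    remaining ones, so the masses add up, and [1 - a - b <= (1 - a) (1 - b)] separates the two
    factors. *)
Lemma avoidance_le_cluster_sum K N V i0 z : i0 \in V -> (#|V| <= K)%N ->
  avoidance N V z <= \sum_(A : {set 'I_n} | (A \subset V) && (i0 \in A))
    cluster_avoidance K N A z * avoidance N (V :\: A) z.
Proof.
move=> i0V VK.
have [A [c [AV i0A cA Ac disj]]] := exists_cluster sphere0 t01 z i0V VK.
rewrite (bigD1 A)/=; last by rewrite AV.
apply: le_trans (_ : _ <= cluster_avoidance K N A z * avoidance N (V :\: A) z) _; last first.
  rewrite lerDl sumr_ge0// => B _.
  by rewrite mulr_ge0 ?cluster_avoidance_ge0 ?avoidance_ge0.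
rewrite /cluster_avoidance [\1_(clustered _ _) z]indicE mem_set ?mul1r; last by exists c.
rewrite /avoidance [\1_(separated V) z]indicE.
have [sV|sV] := boolP (z \in separated V); last first.
  have pow0 B : 0 <= (1 - cells_mass B z) ^+ N.
    by rewrite exprn_ge0//; case/andP: (cells_mass01 B z).
  by rewrite mul0r !mulr_ge0.
move: sV; rewrite inE => sV.
have sA := separatedS AV sV; have sVA := separatedS (finset.subsetDl V A) sV.
rewrite !indicE !mem_set//.
rewrite !mul1r -exprMn.
have /andP[V0 V1] := cells_mass01 V z.
have /andP[A0 A1] := cells_mass01 A z.
have /andP[B0 B1] := cells_mass01 (V :\: A) z.
rewrite lerXn2r ?nnegrE ?mulr_ge0// (cells_massU AV disj).
nra.
Qed.

Variable nu : probability (n.-tuple (d.-tuple R)) R.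
Hypothesis nu_box : forall A : 'I_n -> set (d.-tuple R),
  (forall i, measurable (A i)) -> nu (box A) = (\prod_(i < n) mu (A i))%E.

(** The two factors depend on the points in [A] and in [V :\: A] respectively, so their expectations
    multiply. *)
Lemma integral_avoidance_le K N V i0 : i0 \in V -> (#|V| <= K)%N ->
  (\int[nu]_z (avoidance N V z)%:E <=
   \sum_(A : {set 'I_n} | (A \subset V) && (i0 \in A))
     (\int[nu]_z (cluster_avoidance K N A z)%:E) *
     (\int[nu]_z (avoidance N (V :\: A) z)%:E))%E.
Proof.
move=> i0V VK.
have mcl A : measurable_fun [set: n.-tuple (d.-tuple R)]
    (fun z => (cluster_avoidance K N A z)%:E).
  by apply/measurable_EFinP; exact: measurable_cluster_avoidance.
have mav A : measurable_fun [set: n.-tuple (d.-tuple R)]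
    (fun z => (avoidance N A z)%:E).
  by apply/measurable_EFinP; exact: measurable_avoidance.
rewrite -[leRHS]big_filter; set s := [seq A <- _ | _].
apply: (@le_trans _ _ (\int[nu]_z \sum_(A <- s)
    ((cluster_avoidance K N A z)%:E * (avoidance N (V :\: A) z)%:E))%E).
  apply: ge0_le_integral => //.
  - by move=> z _; rewrite lee_fin avoidance_ge0.
  - by apply: emeasurable_sum => A; exact: emeasurable_funM.
  - move=> z _; rewrite (eq_bigr (fun A => (cluster_avoidance K N A z *
      avoidance N (V :\: A) z)%:E))// sumEFin lee_fin big_filter.
    exact: avoidance_le_cluster_sum.
rewrite ge0_integral_sum//; last 2 first.
- by move=> A; exact: emeasurable_funM.
- by move=> A z _; rewrite mule_ge0// lee_fin ?cluster_avoidance_ge0 ?avoidance_ge0.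
apply: lee_sum => A _; rewrite (integralM_free_of nu_box (A := A))//.
- by move=> z; rewrite lee_fin cluster_avoidance_ge0.
- by move=> z; rewrite lee_fin avoidance_ge0.
- by move=> i iA z x; rewrite cluster_avoidance_free.
- by move=> i iA z x; rewrite avoidance_free// finset.in_setD iA.
Qed.


Lemma cells_mass1 i z : cells_mass [set i]%SET z = t.
Proof.
apply: EFin_inj; rewrite -cells_massE -(mass_dilated_cell1 sphere0 t01 (tnth z i)).
congr (mu _); apply/seteqP; split => [y [j [ji yj]]|y yi].
  by move: ji yj; rewrite inE => /eqP ->.
by exists i; split => //; rewrite inE.
Qed.

Lemma cluster_avoidance_le_expR K N A z (m : R) : m <= cells_mass A z ->
  cluster_avoidance K N A z <= expR (- (N%:R * m)).
Proof.
move=> mA; have /andP[c0 c1] := cells_mass01 A z.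
apply: (@le_trans _ _ ((1 - cells_mass A z) ^+ N)).
  by rewrite /cluster_avoidance /avoidance mulrA ler_piMl ?exprn_ge0.
apply: le_trans (le_expR_1Bx N _) _; first by rewrite -subr_ge0.
by rewrite ler_expR lerN2 ler_wpM2l.
Qed.

Lemma integral_cst_probability (c : R) : (\int[nu]_z (cst c%:E z) = c%:E)%E.
Proof. by rewrite integral_cst// [X in (_ * X)%E]probability_setT mule1. Qed.

Lemma integral_singleton_avoidance_le K N i :
  (\int[nu]_z (cluster_avoidance K N [set i]%SET z)%:E <= ((1 - t) ^+ N)%:E)%E.
Proof.
rewrite -integral_cst_probability; apply: ge0_le_integral => //.
- by move=> z _; rewrite lee_fin cluster_avoidance_ge0.
- by apply/measurable_EFinP; exact: measurable_cluster_avoidance.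
move=> z _ /=; rewrite lee_fin /cluster_avoidance /avoidance mulrA cells_mass1.
by rewrite ler_piMl ?exprn_ge0//; case/andP: t01 => *; lra.
Qed.

(** Given a centre in [S], the points indexed by [s] are independent and each lies in the dilated
    cell with probability at most [q]. *)
Lemma integral_dilated_neighbors (rho q : R) c (s : seq 'I_n) :
  0 <= q -> uniq s -> c \notin s ->
  (forall x, S x -> (mu (dilated_cell mu t rho x) <= q%:E)%E) ->
  (\int[nu]_z (\1_S (tnth z c) * \prod_(j <- s)
     \1_(dilated_cell mu t rho (tnth z c)) (tnth z j))%:E <= (q ^+ size s)%:E)%E.
Proof.
move=> q0 us cs Hq.
pose D := [set p : n.-tuple (d.-tuple R) * d.-tuple R |
  dilated_cell mu t rho (tnth p.1 c) p.2].
have mD : measurable D.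
  apply: measurable_dilated_cell_rel; last exact: measurable_snd.
  exact: (measurableT_comp (measurable_tnth c) measurable_fst).
have xD z : xsection D z = dilated_cell mu t rho (tnth z c).
  by apply/seteqP; split => x; rewrite /xsection /= inE.
have m1 : measurable_fun [set: n.-tuple (d.-tuple R)]
    (fun z => \1_S (tnth z c) : R).
  by apply: measurableT_comp; [exact: measurable_indic|exact: measurable_tnth].
have := integral_prod_xsection nu_box us mD m1.
under eq_integral do rewrite xD.
move=> ->//; last 2 first.
- move=> j js z x; rewrite tnth_set_tnth.
  by case: eqP => // cj; move: cs; rewrite cj js.
- move=> j js z x; rewrite !xD tnth_set_tnth.
  by case: eqP => // cj; move: cs; rewrite cj js.
rewrite -integral_cst_probability; apply: ge0_le_integral => //.
- by move=> z _; rewrite lee_fin mulr_ge0// exprn_ge0// fine_ge0.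
- apply/measurable_EFinP; apply: measurable_funM => //.
  by apply: measurable_funX; exact: measurable_mass_xsection.
move=> z _; rewrite lee_fin xD indicE.
have [Sz|_] := boolP (tnth z c \in S); last by rewrite mul0r exprn_ge0.
rewrite mul1r lerXn2r ?nnegrE ?fine_ge0// -lee_fin fineK; last first.
  by rewrite fin_num_measure//; exact: measurable_dilated_cell.
by apply: Hq; rewrite inE in Sz.
Qed.

(** Two cells whose centres avoid each other's cell already cover [t + t] minus an overlap of at
    most [b * t]. *)
Lemma separated_pair_mass (b : R) A z :
  (forall x y, S x -> S y -> ~ dilated_cell mu t 1 x y -> ~ dilated_cell mu t 1 y x ->
    (mu (dilated_cell mu t 1 x `&` dilated_cell mu t 1 y) <= (b * t)%:E)%E) ->
  (1 < #|A|)%N -> separated A z -> (2 - b) * t <= cells_mass A z.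
Proof.
move=> Hb /card_gt1P[i [j [iA jA ij]]] sz.
have [Si Hi] := sz i iA; have [Sj Hj] := sz j jA.
have := Hb _ _ Si Sj (Hi j _) (Hj i _).
rewrite iA jA ij eq_sym ij => /(_ erefl erefl) {}Hb.
set Ci := dilated_cell mu t 1 (tnth z i) in Hb.
set Cj := dilated_cell mu t 1 (tnth z j) in Hb.
have mCi : measurable Ci by exact: measurable_dilated_cell.
have mCj : measurable Cj by exact: measurable_dilated_cell.
have mI : measurable (Ci `&` Cj) by exact: measurableI.
have sub : (mu (Ci `|` Cj) <= mu (cells A z))%E.
  apply: le_measure; rewrite ?inE; [exact: measurableU|exact: measurable_cells|].
  by move=> y [yi|yj]; [exists i|exists j].
have CiT : mu Ci = t%:E by exact: mass_dilated_cell1.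
have CjT : mu Cj = t%:E by exact: mass_dilated_cell1.
have finI : mu (Ci `&` Cj) = (fine (mu (Ci `&` Cj)))%:E.
  by rewrite fineK// fin_num_measure.
have UE : mu (Ci `|` Cj) = (t + t - fine (mu (Ci `&` Cj)))%:E.
  rewrite measureUfinl//; last by apply: le_lt_trans (ltry 1); exact: probability_le1.
  rewrite EFinB EFinD; congr (_ + _ - _)%E; [exact: CiT|exact: CjT|exact: finI].
move: sub Hb; rewrite UE finI cells_massE !lee_fin => *; lra.
Qed.

(** A union bound over the centre [c] gives the factor [#|A|]. Each of the other [#|A| - 1] points
    must lie in the dilated cell of [c], and the exponential comes from [separated_pair_mass]. *)
Lemma integral_cluster_avoidance_le K N (b C : R) A :
  (forall x y, S x -> S y -> ~ dilated_cell mu t 1 x y -> ~ dilated_cell mu t 1 y x ->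
    (mu (dilated_cell mu t 1 x `&` dilated_cell mu t 1 y) <= (b * t)%:E)%E) ->
  0 <= C ->
  (forall x, S x -> (mu (dilated_cell mu t (2 * K%:R) x) <= (C * t)%:E)%E) ->
  (1 < #|A|)%N ->
  (\int[nu]_z (cluster_avoidance K N A z)%:E <=
   (#|A|%:R * (C * t) ^+ #|A|.-1 * expR (- (N%:R * ((2 - b) * t))))%:E)%E.
Proof.
move=> Hb C0 HC A1; set e := expR _.
have t0 : 0 <= t by case/andP: t01 => /ltW.
pose f c z : R := \1_S (tnth z c) * \prod_(j <- enum (A :\ c))
  \1_(dilated_cell mu t (2 * K%:R) (tnth z c)) (tnth z j).
have f0 c z : 0 <= f c z by rewrite mulr_ge0// prodr_ge0.
have mf c : measurable_fun [set: n.-tuple (d.-tuple R)] (fun z => (f c z)%:E).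
  apply/measurable_EFinP; apply: measurable_funM.
    by apply: measurableT_comp; [exact: measurable_indic|exact: measurable_tnth].
  apply: measurable_prod => j _.
  rewrite (_ : (fun _ => _) = \1_[set z : n.-tuple (d.-tuple R) |
    dilated_cell mu t (2 * K%:R) (tnth z c) (tnth z j)]); last first.
    by apply/funext => z; rewrite !indicE; congr (_ : bool)%:R; apply/idP/idP;
      rewrite !inE.
  by apply/measurable_indic; apply: measurable_dilated_cell_rel; exact: measurable_tnth.
apply: (@le_trans _ _ (\int[nu]_z \sum_(c <- enum A) (e%:E * (f c z)%:E))%E).
  apply: ge0_le_integral => //.
  - by move=> z _; rewrite lee_fin cluster_avoidance_ge0.
  - by apply/measurable_EFinP; exact: measurable_cluster_avoidance.
  - by apply: emeasurable_sum => c; exact: emeasurable_funM.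
  - move=> z _; rewrite (eq_bigr (fun c => (e * f c z)%:E))// sumEFin lee_fin.
    have s0 : 0 <= \sum_(c <- enum A) e * f c z.
      by apply: sumr_ge0 => c _; rewrite mulr_ge0// expR_ge0.
    have [[sz [c [cA Hc]]]|nsc] := pselect (separated A z /\ clustered K A z).
      have fc : f c z = 1.
        rewrite /f indicE mem_set; last by have [] := sz c cA.
        rewrite mul1r big1_seq// => j /andP[_]; rewrite mem_enum inE => /andP[_ jA].
        by rewrite indicE mem_set//; exact: Hc.
      rewrite (bigD1_seq c) ?mem_enum ?enum_uniq//= fc mulr1.
      apply: ler_wpDr; first by apply: sumr_ge0 => j _; rewrite mulr_ge0// expR_ge0.
      by apply: cluster_avoidance_le_expR; exact: separated_pair_mass Hb A1 sz.
    apply: le_trans s0; rewrite /cluster_avoidance /avoidance mulrA !indicE -natrM mulnb.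
    have [/andP[]|_] := boolP (_ && _); last by rewrite mul0r.
    by rewrite !inE => cz sz; exfalso; apply: nsc.
rewrite ge0_integral_sum//; last 2 first.
- by move=> c; exact: emeasurable_funM.
- by move=> c z _; rewrite mule_ge0// lee_fin ?expR_ge0.
apply: (@le_trans _ _ (\sum_(c <- enum A) (e * (C * t) ^+ #|A|.-1)%:E)%E).
  rewrite big_seq [leRHS]big_seq; apply: lee_sum => c; rewrite mem_enum => cA.
  rewrite ge0_integralZl ?lee_fin ?expR_ge0//; last by move=> z _; rewrite lee_fin.
  rewrite [leRHS]EFinM; apply: lee_wpmul2l; first by rewrite lee_fin expR_ge0.
  have -> : #|A|.-1 = size (enum (A :\ c)).
    by rewrite -cardE (cardsD1 c A) cA.
  apply: integral_dilated_neighbors => //; first by rewrite mulr_ge0.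
    by rewrite enum_uniq.
  by rewrite mem_enum !inE eqxx.
rewrite sumEFin lee_fin big_enum/= sumr_const -[leLHS]mulr_natl.
by rewrite mulrCA mulrC.
Qed.

End cluster_integrals.

(** * Probability of simultaneous exceedance *)

Lemma measure_exists_le d (T : measurableType d) (R : realType)
    (m : {measure set T -> \bar R}) (I : choiceType) (s : seq I) (F : I -> set T)
    (c : R) : (forall i, measurable (F i)) ->
  (forall i, i \in s -> (m (F i) <= c%:E)%E) ->
  (m [set x | exists i, i \in s /\ F i x] <= ((size s)%:R * c)%:E)%E.
Proof.
move=> mF.
have mE (s' : seq I) : measurable [set x | exists i, i \in s' /\ F i x].
  rewrite (_ : [set _ | _] = \big[setU/set0]_(i <- s') F i).
    by apply: bigsetU_measurable.
  by rewrite -bigcup_seq; apply/seteqP; split => x [i] => [[si Fi]|si Fi]; exists i.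
elim: s => [|i s IH] Hs.
  rewrite mul0r (_ : [set _ | _] = set0) ?measure0//.
  by apply/seteqP; split => x // -[i []].
apply: (@le_trans _ _ (m (F i `|` [set x | exists j, j \in s /\ F j x]))).
  apply: le_measure; rewrite ?inE; [exact: mE|exact: measurableU|].
  move=> x [j [+ Fj]]; rewrite inE => /predU1P[<-|js]; first by left.
  by right; exists j.
apply: le_trans (measureU2 _ _ _) _; [exact: mF|exact: mE|].
rewrite /= -natr1 mulrDl mul1r addrC EFinD; apply: leeD.
  by apply: IH => j js; apply: Hs; rewrite inE js orbT.
by apply: Hs; exact: mem_head.
Qed.

Section exceedance_probability.
Context {R : realType} {d : nat}.
Variable mu : probability (d.-tuple R) R.
Hypothesis sphere0 : forall x r, mu [set y | eucl_dist y x = r] = 0%E.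
Variable t : R.
Hypothesis t01 : 0 < t < 1.
Variable S : set (d.-tuple R).
Hypotheses (mS : measurable S) (S1 : mu S = 1%E).
Variable n : nat.
Implicit Types (z : n.-tuple (d.-tuple R)) (i j : 'I_n) (A V : {set 'I_n}).
Variable nu : probability (n.-tuple (d.-tuple R)) R.
Hypothesis nu_box : forall A : 'I_n -> set (d.-tuple R),
  (forall i, measurable (A i)) -> nu (box A) = (\prod_(i < n) mu (A i))%E.

Local Notation cells := (cells mu t).
Local Notation separated := (separated mu t S).
Local Notation avoidance := (avoidance mu t S).

Lemma nu_coordinate i (B : set (d.-tuple R)) : measurable B ->
  nu [set z | B (tnth z i)] = mu B.
Proof.
move=> mB; pose A j := if j == i then B else setT.
have mA j : measurable (A j) by rewrite /A; case: ifP.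
have -> : [set z : n.-tuple (d.-tuple R) | B (tnth z i)] = box A.
  apply/seteqP; split => z /=.
    by move=> Bz j; rewrite /A; case: eqP => // ->.
  by move=> /(_ i); rewrite /A eqxx.
rewrite nu_box// (bigD1 i)//= /A eqxx big1 ?mule1// => j /negbTE ->.
by rewrite probability_setT.
Qed.

Lemma nu_cell_pair i j : i != j ->
  (nu [set z | dilated_cell mu t 1%R (tnth z i) (tnth z j)] <= t%:E)%E.
Proof.
move=> ij; have t0 : 0 <= t by case/andP: t01 => /ltW.
(* One neighbour and an unconstrained centre: [rho = 1], [q = t], [s = [:: j]], with [setT] for
   [S]. *)
have := @integral_dilated_neighbors _ _ mu t setT measurableT n nu nu_box 1 t i [:: j] t0.
rewrite /= inE => /(_ erefl ij) H.
have mE : measurable [set z : n.-tuple (d.-tuple R) |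
    dilated_cell mu t 1%R (tnth z i) (tnth z j)].
  by apply: measurable_dilated_cell_rel; exact: measurable_tnth.
rewrite -[X in nu X]setIT -(integral_indic nu measurableT mE).
apply: le_trans (H _); last by move=> x _; rewrite mass_dilated_cell1.
rewrite le_eqVlt; apply/orP; left; apply/eqP; apply: eq_integral => z _.
by rewrite big_seq1 indicT mul1r.
Qed.

Lemma nu_not_separated V : (nu (~` separated V) <= (#|V|%:R ^+ 2 * t)%:E)%E.
Proof.
have t0 : 0 <= t by case/andP: t01 => /ltW.
pose s := [seq (i, j) | i <- enum V, j <- enum V].
(* Diagonal pairs encode the null event that a point leaves [S], the others that one point lies in
   the cell of another. *)
pose F (p : 'I_n * 'I_n) : set (n.-tuple (d.-tuple R)) :=
  if p.1 == p.2 then [set z | (~` S) (tnth z p.1)]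
  else [set z | dilated_cell mu t 1 (tnth z p.1) (tnth z p.2)].
have mF p : measurable (F p).
  rewrite /F; case: ifP => _.
    rewrite -[X in measurable X]setTI; apply: (measurable_tnth _ measurableT).
    exact: measurableC.
  by apply: measurable_dilated_cell_rel; exact: measurable_tnth.
have := @measure_exists_le _ _ _ nu _ s F t mF.
rewrite /s size_allpairs -!cardE natrM -expr2 => H.
apply: le_trans (H _); last first.
  move=> [i j] _; rewrite /F /=; case: eqVneq => [_|ij]; last exact: nu_cell_pair.
  have -> // : (nu [set z | (~` S) (tnth z i)] <= t%:E)%E.
  rewrite nu_coordinate; last exact: measurableC.
  by rewrite probability_setC// S1 subee.
apply: le_measure; rewrite ?inE.
- by apply: measurableC; exact: measurable_separated.
- apply: (@measurable_exists _ _ ('I_n * 'I_n)%type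
    (fun p z => p \in [seq (i, j) | i <- enum V, j <- enum V] /\ F p z)) => p.
  by apply: measurable_andb; exact: mF.
move=> z /= sz; apply: contrapT => /forallNP Hz; apply: sz => i iV; split.
  apply: contrapT => Si; apply: (Hz (i, i)); split; last by rewrite /F eqxx.
  by apply/allpairsP; exists (i, i); rewrite !mem_enum.
move=> j /andP[jV ji] ij; apply: (Hz (i, j)); split; last first.
  by rewrite /F /= eq_sym (negbTE ji).
by apply/allpairsP; exists (i, j); rewrite !mem_enum.
Qed.

Lemma cells_mass_le V z : cells_mass mu t V z <= #|V|%:R * t.
Proof.
rewrite -lee_fin -cells_massE cardE.
have -> : cells V z = [set x | exists i, i \in enum V /\ dilated_cell mu t 1 (tnth z i) x].
  by apply/seteqP; split => x [i [iV xi]]; exists i; split => //; move: iV;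
    rewrite mem_enum.
apply: measure_exists_le => [i|i _]; first exact: measurable_dilated_cell.
have -> // : (mu (dilated_cell mu t 1 (tnth z i)) <= t%:E)%E.
by rewrite mass_dilated_cell1.
Qed.

(** The cells of [V] cover mass at most [#|V| * t], and separation fails with probability at most
    [#|V| ^+ 2 * t]. *)
Lemma integral_avoidance_ge N V : #|V|%:R * t <= 1 ->
  (((1 - #|V|%:R * t) ^+ N * (1 - #|V|%:R ^+ 2 * t))%:E <=
   \int[nu]_z (avoidance N V z)%:E)%E.
Proof.
move=> Vt; have pow0 : 0 <= (1 - #|V|%:R * t) ^+ N by rewrite exprn_ge0// subr_ge0.
have mI : measurable_fun [set: n.-tuple (d.-tuple R)]
    (fun z => (\1_(separated V) z)%:E : \bar R).
  by apply/measurable_EFinP; apply: measurable_indic; exact: measurable_separated.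
apply: (@le_trans _ _ (\int[nu]_z
    (((1 - #|V|%:R * t) ^+ N)%:E * (\1_(separated V) z)%:E))%E).
  rewrite ge0_integralZl//.
  rewrite integral_indic// ?setIT; last exact: measurable_separated.
  rewrite EFinM; apply: lee_wpmul2l => //.
  have msep : measurable (separated V) by exact: measurable_separated.
  have : 1 - fine (nu (separated V)) <= #|V|%:R ^+ 2 * t.
    have := nu_not_separated V; rewrite probability_setC//.
    by rewrite -[X in (1 - X)%E]fineK ?fin_num_measure// -EFinB lee_fin.
  by move=> h; rewrite -[leRHS]fineK ?fin_num_measure// lee_fin; lra.
apply: ge0_le_integral => //.
- by move=> z _; rewrite mule_ge0// lee_fin.
- exact: emeasurable_funM.
- by apply/measurable_EFinP; exact: measurable_avoidance.
move=> z _; rewrite -EFinM lee_fin /avoidance mulrC; apply: ler_wpM2l => //.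
by rewrite lerXn2r ?nnegrE ?subr_ge0 ?lerD2l ?lerN2 ?cells_mass_le//;
  case/andP: (cells_mass01 mu t V z) => ? _; lra.
Qed.

Definition exceedance i : set (n.-tuple (d.-tuple R)) :=
  [set z | forall j, j != i -> ~ dilated_cell mu t 1 (tnth z i) (tnth z j)].

Lemma measurable_exceedance i : measurable (exceedance i).
Proof.
apply: measurable_forall => j; apply: measurable_imply; apply: measurableC.
by apply: measurable_dilated_cell_rel; exact: measurable_tnth.
Qed.

(** Up to a null event, joint exceedance means that the points of [V] are separated and that the
    other [n - #|V|] points, independent of them, avoid the union of their cells. *)
Lemma nu_exceedances V :
  nu [set z | forall i, i \in V -> exceedance i z] =
  (\int[nu]_z (avoidance (n - #|V|) V z)%:E)%E.
Proof.
pose D := ~` [set p : n.-tuple (d.-tuple R) * d.-tuple R | cells V p.1 p.2].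
have mD : measurable D by apply: measurableC; exact: measurable_cells_rel.
have xD z : xsection D z = ~` cells V z.
  by apply/seteqP; split => x; rewrite /xsection /= inE.
have msep : measurable (separated V) by exact: measurable_separated.
pose X' := [set z | separated V z /\ forall j, j \notin V -> ~ cells V z (tnth z j)].
have indX' z : \1_X' z = \1_(separated V) z *
    \prod_(j <- enum (~: V)) \1_(xsection D z) (tnth z j) :> R.
  rewrite !indicE; have [zX|zX] := boolP (z \in X').
    move: zX; rewrite inE => -[sz Hz].
    rewrite mem_set// mul1r big1_seq// => j /andP[_]; rewrite mem_enum inE => jV.
    by rewrite indicE mem_set// xD; exact: Hz.
  have [zs|] := boolP (z \in separated V); last by rewrite mul0r.
  have [j [jV cj]] : exists j, j \notin V /\ cells V z (tnth z j).
    apply: contrapT => /forallNP H; move/negP : zX; apply; rewrite inE.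
    split; first by rewrite inE in zs.
    by move=> j jV cj; apply: (H j).
  rewrite mul1r (bigD1_seq j) ?enum_uniq ?mem_enum ?inE//= indicE memNset ?mul0r//.
  by rewrite xD => /(_ cj).
have mX' : measurable X'.
  apply: measurableI => //; apply: measurable_forall => j; apply: measurable_imply.
  apply: measurableC; apply: measurable_exists => i; apply: measurable_andb.
  by apply: measurable_dilated_cell_rel; exact: measurable_tnth.
have mX : measurable [set z | forall i, i \in V -> exceedance i z].
  apply: measurable_forall => i; apply: measurable_imply; exact: measurable_exceedance.
(* [separated] also requires the points to lie in [S]; the two events agree on the almost sure event
   [Y]. *)
pose Y : set (n.-tuple (d.-tuple R)) := box (fun=> S).
have mY : measurable Y by exact: measurable_box.
have Y1 : nu Y = 1%E by rewrite nu_box// big1.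
transitivity (nu X').
  apply/eqP; rewrite eq_le; apply/andP; split; last first.
    apply: le_measure; rewrite ?inE// => z [sz Hz] i iV j ji ij.
    have [jV|jV] := boolP (j \in V).
      by have [_ Hi] := sz i iV; apply: (Hi j) => //; rewrite jV.
    by apply: (Hz j jV); exists i.
  have YC0 : nu (~` Y) = 0%E by rewrite probability_setC// Y1 subee.
  rewrite -[leRHS]adde0 -YC0; apply: le_trans (measureU2 _ _ _) => //; last exact: measurableC.
  apply: le_measure; rewrite ?inE//; first by apply: measurableU => //; exact: measurableC.
  move=> z Hz; have [Yz|] := pselect (Y z); [left|by right].
  split => [i iV|j jV [i [iV ij]]].
    by split => [|j /andP[jV ji]]; [exact: Yz|apply: Hz].
  by apply: (Hz i iV j _ ij); apply: contra jV => /eqP ->.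
rewrite -[X in nu X]setIT -(integral_indic nu measurableT mX').
under eq_integral do rewrite indX'.
rewrite (integral_prod_xsection nu_box)//.
- apply: eq_integral => z _; congr (_%:E); rewrite /avoidance xD -cardE.
  congr (_ * _ ^+ _); last first.
    have key a b : (a + b = n -> b = n - a)%N by move=> <-; rewrite addKn.
    exact: (key _ _ (etrans (cardsC V) (card_ord n))).
  rewrite probability_setC; last exact: measurable_cells.
  by rewrite cells_massE.
- exact: enum_uniq.
- move=> j; rewrite mem_enum inE => jV z x; rewrite !indicE.
  by congr (_ : bool)%:R; apply/idP/idP; rewrite !inE => H;
    apply/(separated_free mu t S z x jV).
- by move=> j; rewrite mem_enum inE => jV z x; rewrite !xD cells_free.
Qed.

End exceedance_probability.

Section small_cells.
Context {R : realType} {d : nat}.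
Variable mu : probability (d.-tuple R) R.
Hypothesis sphere0 : forall x r, mu [set y | eucl_dist y x = r] = 0%E.
Variables (beta cmax delta : R).
Hypothesis delta_gt0 : 0 < delta.
Hypothesis mu_balls : forall (r s : R) (x z : d.-tuple R),
  0 < r -> 0 < s -> measure_supp mu x -> measure_supp mu z ->
  Num.max r s <= eucl_dist x z ->
  mu (eucl_ball x r) = mu (eucl_ball z s) -> (mu (eucl_ball z s) <= delta%:E)%E ->
  fine (mu (eucl_ball x r `&` eucl_ball z s)) / fine (mu (eucl_ball z s)) <= beta /\
  (mu (eucl_ball z (2 * s)) <= cmax%:E * mu (eucl_ball z s))%E.

(** Both cells have mass [t], and the distance of the centres exceeds both radii, which is the
    setting of [mu_balls]. *)
Lemma separated_cells_overlap (t : R) x z : 0 < t < 1 -> t <= delta ->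
  measure_supp mu x -> measure_supp mu z ->
  ~ dilated_cell mu t 1 x z -> ~ dilated_cell mu t 1 z x ->
  (mu (dilated_cell mu t 1 x `&` dilated_cell mu t 1 z) <= (beta * t)%:E)%E.
Proof.
move=> t01 td sx sz; have [rad Hrad] := cell_radius sphere0 t01.
have [rx0 rxt ->//] := Hrad x; have [rz0 rzt ->//] := Hrad z.
rewrite !mul1r /eucl_ball /= => /negP; rewrite -ltNge => xz /negP.
rewrite -ltNge => zx.
have [] := mu_balls rx0 rz0 sx sz _ _ _.
- by rewrite ge_max (ltW zx) eucl_distC (ltW xz).
- by rewrite !ball_massE rxt rzt.
- by rewrite ball_massE rzt lee_fin.
move=> + _; rewrite -/(ball_mass mu z (rad z)) rzt ler_pdivrMr; last by case/andP: t01.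
rewrite -lee_fin fineK// fin_num_measure//.
by apply: measurableI; exact: measurable_eucl_ball.
Qed.

Lemma dilated_cell_mass_le (K : nat) : (0 < K)%N -> exists e C, [/\ 0 < e, 0 <= C &
  forall (t : R) x, 0 < t < 1 -> t <= e -> measure_supp mu x ->
    (mu (dilated_cell mu t (2 * K%:R) x) <= (C * t)%:E)%E].
Proof.
move=> K0.
(* [2 * K] doublings are enough, since [2 * K < 2 ^ (2 * K)]. *)
have [e [C [e0 C0 H]]] := small_ball_doubling_iter sphere0 delta_gt0 mu_balls (2 * K).
exists e, C; split => //; first exact: ltW.
move=> t x t01 te sx; have [rad Hrad] := cell_radius sphere0 t01.
have [rx0 rxt ->] := Hrad x; last by rewrite mulr_gt0// ltr0n.
rewrite ball_massE lee_fin -[in leRHS]rxt; apply: le_trans (H x _ sx rx0 _); last first.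
  by rewrite rxt.
apply: le_ball_mass; apply: ler_wpM2r; first exact: ltW.
by rewrite -natrM -natrX ler_nat ltnW// ltn_expl.
Qed.

End small_cells.

(** * Limits of the factorial moments *)

Section factorial_moments.
Context {R : realType} {d : nat}.
Variable mu : probability (d.-tuple R) R.
Hypothesis sphere0 : forall x r, mu [set y | eucl_dist y x = r] = 0%E.
Variables (beta cmax delta : R).
Hypothesis beta01 : 0 < beta < 1.
Hypothesis delta_gt0 : 0 < delta.
Hypothesis mu_balls : forall (r s : R) (x z : d.-tuple R),
  0 < r -> 0 < s -> measure_supp mu x -> measure_supp mu z ->
  Num.max r s <= eucl_dist x z ->
  mu (eucl_ball x r) = mu (eucl_ball z s) -> (mu (eucl_ball z s) <= delta%:E)%E ->
  fine (mu (eucl_ball x r `&` eucl_ball z s)) / fine (mu (eucl_ball z s)) <= beta /\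
  (mu (eucl_ball z (2 * s)) <= cmax%:E * mu (eucl_ball z s))%E.
Variable nu : forall n, probability (n.-tuple (d.-tuple R)) R.
Hypothesis nu_box : forall n (A : 'I_n -> set (d.-tuple R)),
  (forall i, measurable (A i)) -> nu n (box A) = (\prod_(i < n) mu (A i))%E.
Variable S : set (d.-tuple R).
Hypotheses (mS : measurable S) (S1 : mu S = 1%E) (Ssupp : S `<=` measure_supp mu).
Variable y : R.

Definition mean_avoidance n (N : nat) (V : {set 'I_n}) : R :=
  fine (\int[nu n]_z (avoidance mu (thr y n) S N V z)%:E)%E.

Definition mean_cluster n (K N : nat) (A : {set 'I_n}) : R :=
  fine (\int[nu n]_z (cluster_avoidance mu (thr y n) S K N A z)%:E)%E.

Lemma integral_01_fin n (f : n.-tuple (d.-tuple R) -> R) :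
  measurable_fun setT f -> (forall z, 0 <= f z <= 1) ->
  (\int[nu n]_z (f z)%:E)%E \is a fin_num /\ fine (\int[nu n]_z (f z)%:E)%E <= 1.
Proof.
move=> mf f01.
have le1 : (\int[nu n]_z (f z)%:E <= 1%:E)%E.
  rewrite -(integral_cst_probability (nu n)); apply: ge0_le_integral => //.
  - by move=> z _; rewrite lee_fin; case/andP: (f01 z).
  - exact/measurable_EFinP.
  - by move=> z _; rewrite lee_fin; case/andP: (f01 z).
have ge0 : (0 <= \int[nu n]_z (f z)%:E)%E.
  by apply: integral_ge0 => z _; rewrite lee_fin; case/andP: (f01 z).
have fn : (\int[nu n]_z (f z)%:E)%E \is a fin_num.
  by rewrite ge0_fin_numE// (le_lt_trans le1)// ltry.
by split => //; rewrite -lee_fin fineK.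
Qed.

Lemma avoidance01 t n N (V : {set 'I_n}) z : 0 <= avoidance mu t S N V z <= 1.
Proof.
rewrite avoidance_ge0/= /avoidance.
have /andP[? ?] := cells_mass01 mu t V z.
by rewrite mulr_ile1// ?exprn_ge0// exprn_ile1.
Qed.

Lemma cluster_avoidance01 t n K N (V : {set 'I_n}) z :
  0 <= cluster_avoidance mu t S K N V z <= 1.
Proof.
have /andP[? ?] := avoidance01 t N V z.
by rewrite cluster_avoidance_ge0/= mulr_ile1.
Qed.

Lemma mean_avoidanceE n N (V : {set 'I_n}) :
  (\int[nu n]_z (avoidance mu (thr y n) S N V z)%:E)%E = (mean_avoidance N V)%:E.
Proof.
rewrite fineK//; apply: (integral_01_fin _ _).1; last by move=> z; exact: avoidance01.
exact: measurable_avoidance.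
Qed.

Lemma mean_clusterE n K N (A : {set 'I_n}) :
  (\int[nu n]_z (cluster_avoidance mu (thr y n) S K N A z)%:E)%E =
  (mean_cluster K N A)%:E.
Proof.
rewrite fineK//; apply: (integral_01_fin _ _).1; last by move=> z; exact: cluster_avoidance01.
exact: measurable_cluster_avoidance.
Qed.

Lemma mean_avoidance_ge0 n N (V : {set 'I_n}) : 0 <= mean_avoidance N V.
Proof.
by apply: fine_ge0; apply: integral_ge0 => z _; rewrite lee_fin avoidance_ge0.
Qed.

Lemma mean_avoidance_le1 n N (V : {set 'I_n}) : mean_avoidance N V <= 1.
Proof.
apply: (integral_01_fin _ _).2; last by move=> z; exact: avoidance01.
exact: measurable_avoidance.
Qed.

Lemma mean_cluster_ge0 n K N (A : {set 'I_n}) : 0 <= mean_cluster K N A.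
Proof.
by apply: fine_ge0; apply: integral_ge0 => z _; rewrite lee_fin cluster_avoidance_ge0.
Qed.

(** The case [c = 1] keeps the shape of [cvg_expXpow], whence the exponent [1] and the coefficient
    [1]. *)
Definition cluster_bound (K : nat) (C : R) (c n : nat) : R :=
  if c == 1%N then n%:R ^+ 1 * (1 - 1%:R * thr y n) ^+ (n - K)
  else c%:R * (n%:R ^+ c * (C * thr y n) ^+ c.-1 *
               expR (- ((n - K)%:R * ((2 - beta) * thr y n)))).

Lemma near_mean_cluster_le (K : nat) : (0 < K)%N -> exists2 C : R, 0 <= C &
  \forall n \near \oo, forall A : {set 'I_n}, (0 < #|A|)%N ->
    n%:R ^+ #|A| * mean_cluster K (n - K) A <= cluster_bound K C #|A| n.
Proof.
move=> K0; have [e [C [e0 C0 HC]]] := dilated_cell_mass_le sphere0 delta_gt0 mu_balls K0.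
exists C => //; near=> n => A A0.
have t0 : 0 < thr y n by near: n; exact: thr_gt0.
have t1 : thr y n <= 2^-1 by near: n; apply: near_thr_le.
have te : thr y n <= e by near: n; exact: near_thr_le.
have td : thr y n <= delta by near: n; exact: near_thr_le.
have t01 : 0 < thr y n < 1 by rewrite t0/=; lra.
rewrite /cluster_bound; case: eqP => [A1|A1].
  have /cards1P[i Ai] : #|A| == 1%N by apply/eqP.
  rewrite A1; apply: ler_wpM2l; first by rewrite exprn_ge0.
  rewrite -lee_fin -mean_clusterE mul1r Ai.
  exact: (integral_singleton_avoidance_le sphere0 t01 mS).
have {A0}A1 : (1 < #|A|)%N by move: A0; case: #|A| A1 => [|[]].
have : mean_cluster K (n - K) A <= #|A|%:R * (C * thr y n) ^+ #|A|.-1 *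
    expR (- ((n - K)%:R * ((2 - beta) * thr y n))).
  rewrite -lee_fin -mean_clusterE.
  apply: (integral_cluster_avoidance_le sphere0 t01 mS (nu_box (n := n))) => //.
  - by move=> x z Sx Sz; apply: (separated_cells_overlap sphere0 mu_balls t01 td); exact: Ssupp.
  - by move=> x Sx; apply: HC => //; exact: Ssupp.
move=> /(ler_wpM2l (exprn_ge0 #|A| (ler0n R n))) h; apply: le_trans h _.
by rewrite le_eqVlt; apply/orP; left; apply/eqP; ring.
Unshelve. all: by end_near. Qed.

Lemma cvg_cluster_bound1 K C : cluster_bound K C 1 n @[n --> \oo] --> expR (- y).
Proof. by have := @cvg_expXpow _ y 1 K; rewrite mul1r. Qed.

Lemma cvg_cluster_bound_gt1 K C c : (1 < c)%N -> 0 <= C ->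
  cluster_bound K C c n @[n --> \oo] --> (0 : R).
Proof.
move=> c1 C0; rewrite /cluster_bound gtn_eqF//.
rewrite -[X in _ --> X](mulr0 c%:R); apply: cvgM; first exact: cvg_cst.
by apply: cvg_cluster_bound => //; case/andP: beta01.
Qed.

(** Induction on [m] through the cluster of one index. The bounds [a m'] do not depend on [V], and
    [K] stays fixed so that all sets face the same number [n - K] of further points. *)
Lemma near_mean_avoidance_le (K : nat) : (0 < K)%N -> forall m, (m <= K)%N ->
  exists a : nat -> nat -> R, forall m', (m' <= m)%N ->
  [/\ forall n, 0 <= a m' n, a m' n @[n --> \oo] --> expR (- y) ^+ m' &
    \forall n \near \oo, forall V : {set 'I_n}, #|V| = m' ->
      n%:R ^+ m' * mean_avoidance (n - K) V <= a m' n].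
Proof.
move=> K0; elim=> [|m IH] mK.
  exists (fun _ _ => 1) => m'; rewrite leqn0 => /eqP ->; split => //.
    by rewrite expr0; exact: cvg_cst.
  by near=> n => V _; rewrite expr0 mul1r mean_avoidance_le1.
have [C C0 HC] := near_mean_cluster_le K0.
have [a Ha] := IH (ltnW mK).
(* For small [n] the bound can be negative; its absolute value has the same limit, because that
   limit is nonnegative. *)
pose b c n : R := `|cluster_bound K C c n|.
pose g c n : R := b c n * a (m.+1 - c)%N n.
(* First the singleton cluster, then the larger clusters: there are at most [2 ^ m.+1] of them, and
   each is bounded by the sum over all sizes from [2] on. *)
pose am n : R := g 1%N n + (2 ^ m.+1)%:R * \sum_(2 <= c < m.+2) g c n.
exists (fun m' => if m' == m.+1 then am else a m') => m'.
case: eqVneq => [-> _|m'm]; last by rewrite leq_eqVlt (negbTE m'm)/= ltnS; exact: Ha.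
have b0 c n : 0 <= b c n by exact: normr_ge0.
have g0 c n : (0 < c)%N -> 0 <= g c n.
  move=> c0; rewrite mulr_ge0//; have [|a0 _ _] := Ha (m.+1 - c)%N; last exact: a0.
  by case: c c0 => // c _; rewrite subSS leq_subr.
have cvgb c l : cluster_bound K C c n @[n --> \oo] --> l -> 0 <= l ->
    b c n @[n --> \oo] --> l.
  by move=> cl l0; rewrite -(ger0_norm l0); exact: cvg_norm.
split.
- move=> n; rewrite addr_ge0 ?g0// mulr_ge0//.
  by rewrite big_nat_cond sumr_ge0// => c /andP[/andP[c2 _] _]; rewrite g0// (leq_trans _ c2).
- rewrite -[X in _ --> X]addr0 exprS -[X in _ --> _ + X](mulr0 (2 ^ m.+1)%:R).
  apply: cvgD.
    apply: cvgM; first by apply: cvgb; [exact: cvg_cluster_bound1|exact: expR_ge0].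
    by rewrite subSS subn0; have [] := Ha m (leqnn m).
  apply: cvgM; first exact: cvg_cst.
  rewrite [X in _ --> X](_ : 0 = \sum_(2 <= c < m.+2) 0); last by rewrite big1.
  rewrite big_seq; under eq_cvg do rewrite big_seq.
  apply: cvg_big => [|c]; first by apply: add_continuous.
  rewrite mem_index_iota => /andP[c2 cm].
  have [|_ al _] := Ha (m.+1 - c)%N.
    by case: c c2 {cm} => // c _; rewrite subSS leq_subr.
  rewrite -(mul0r (expR (- y) ^+ (m.+1 - c))); apply: cvgM => //.
  by apply: cvgb => //; exact: cvg_cluster_bound_gt1.
near=> n => V Vm.
have V0 : (0 < #|V|)%N by rewrite Vm.
have [i0 i0V] : exists i, i \in V by apply/set0Pn; rewrite -card_gt0.
have HCn : forall A : {set 'I_n}, (0 < #|A|)%N ->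
    n%:R ^+ #|A| * mean_cluster K (n - K) A <= cluster_bound K C #|A| n.
  by near: n.
(* Indexing the sizes by a finite type makes their eventual bounds hold simultaneously. *)
have Han : forall (m' : 'I_m.+1) (V : {set 'I_n}), #|V| = m' :> nat ->
    n%:R ^+ m' * mean_avoidance (n - K) V <= a m' n.
  near: n; apply: filter_forall => k.
  by have [|_ _] := Ha k; first by rewrite -ltnS.
have t0 : 0 < thr y n by near: n; exact: thr_gt0.
have t1 : thr y n <= 2^-1 by near: n; apply: near_thr_le.
have t01 : 0 < thr y n < 1 by rewrite t0/=; lra.
have VK : (#|V| <= K)%N by rewrite Vm.
have rec : mean_avoidance (n - K) V <=
    \sum_(A : {set 'I_n} | (A \subset V) && (i0 \in A))
      mean_cluster K (n - K) A * mean_avoidance (n - K) (V :\: A).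
  rewrite -lee_fin -mean_avoidanceE -sumEFin.
  have := integral_avoidance_le sphere0 t01 mS (nu_box (n := n)) (n - K) i0V VK.
  move=> /le_trans; apply; rewrite le_eqVlt; apply/orP; left; apply/eqP.
  by apply: eq_bigr => A _; rewrite EFinM mean_clusterE mean_avoidanceE.
have nk0 k : 0 <= n%:R ^+ k :> R by rewrite exprn_ge0.
apply: le_trans (ler_wpM2l (nk0 m.+1) rec) _; rewrite mulr_sumr.
apply: (@le_trans _ _ (\sum_(A : {set 'I_n} | (A \subset V) && (i0 \in A)) g #|A| n)).
  apply: ler_sum => A /andP[AV iA].
  have A0 : (0 < #|A|)%N by rewrite card_gt0; apply/set0Pn; exists i0.
  have Am : (#|A| <= m.+1)%N by rewrite -Vm subset_leq_card.
  have VA : #|V :\: A| = (m.+1 - #|A|)%N.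
    by rewrite cardsD (finset.setIidPr AV) Vm.
  have -> : n%:R ^+ m.+1 = n%:R ^+ #|A| * n%:R ^+ (m.+1 - #|A|) :> R.
    by rewrite -exprD subnKC.
  rewrite mulrACA; apply: ler_pM.
  - by rewrite mulr_ge0// mean_cluster_ge0.
  - by rewrite mulr_ge0// mean_avoidance_ge0.
  - exact: le_trans (HCn A A0) (ler_norm _).
  - have mA : (m.+1 - #|A| < m.+1)%N by rewrite ltn_subrL A0.
    exact: (Han (Ordinal mA) _ VA).
rewrite (bigID (fun A : {set 'I_n} => #|A| == 1%N))/=; apply: lerD.
  rewrite (big_pred1 [set i0]%SET); first by rewrite cards1.
  move=> A /=; apply/andP/eqP => [[/andP[_ iA] /cards1P[i Ai]]|->].
    by move: iA; rewrite Ai inE => /eqP ->.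
  by rewrite cards1 finset.sub1set i0V inE eqxx.
apply: (@le_trans _ _ (\sum_(A : {set 'I_n} | A \subset V) \sum_(2 <= c < m.+2) g c n)).
  have sum0 : 0 <= \sum_(2 <= c < m.+2) g c n.
    rewrite big_nat_cond sumr_ge0// => c /andP[/andP[c2 _] _].
    by rewrite g0// (leq_trans _ c2).
  rewrite [leRHS](bigID (fun A : {set 'I_n} => (i0 \in A) && (#|A| != 1%N)))/=.
  apply: ler_wpDr; first by apply: sumr_ge0.
  rewrite (eq_bigl (fun A : {set 'I_n} => (A \subset V) && ((i0 \in A) && (#|A| != 1%N))));
    last by move=> A; rewrite andbA.
  apply: ler_sum => A /andP[AV /andP[iA A1]].
  have A0 : (0 < #|A|)%N by rewrite card_gt0; apply/set0Pn; exists i0.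
  have Am : (#|A| <= m.+1)%N by rewrite -Vm subset_leq_card.
  have A2 : (1 < #|A|)%N by rewrite ltn_neqAle eq_sym A1.
  rewrite (bigD1_seq #|A|) ?iota_uniq ?mem_index_iota ?A2 ?ltnS//= lerDl.
  rewrite big_seq_cond sumr_ge0// => c /andP[]; rewrite mem_index_iota => /andP[c2 _] _.
  by rewrite g0// (leq_trans _ c2).
rewrite sumr_const -[leLHS]mulr_natl -Vm -card_powerset.
apply: ler_wpM2r; first by rewrite big_nat_cond sumr_ge0// => c /andP[/andP[c2 _] _];
  rewrite g0// (leq_trans _ c2).
by rewrite ler_nat subset_leq_card//; apply/fintype.subsetP => A; rewrite powersetE.
Unshelve. all: by end_near. Qed.

(** Taking [K = k] makes [n - K] the number of points outside [V], as in [nu_exceedances]. The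
    moment lies between the bounds of [integral_avoidance_ge] and [near_mean_avoidance_le], which
    have the same limit. *)
Lemma near_factorial_moment k (e : R) : 0 < e -> \forall n \near \oo,
  forall V : {set 'I_n}, #|V| = k ->
  `|n%:R ^+ k * fine (nu n [set z | forall i, i \in V -> exceedance mu (thr y n) i z]) -
    expR (- y) ^+ k| <= e.
Proof.
move=> e0; case: (posnP k) => [->|k0].
  near=> n => V /eqP; rewrite cards_eq0 => /eqP ->.
  rewrite (_ : [set _ | _] = setT); last by apply/seteqP; split => // z _ i; rewrite inE.
  by rewrite probability_setT !expr0 mul1r subrr normr0 ltW.
have [a Ha] := near_mean_avoidance_le k0 (leqnn k).
have [_ al Hup] := Ha k (leqnn k).
have lo : n%:R ^+ k * (1 - k%:R * thr y n) ^+ (n - k) * (1 - k%:R ^+ 2 * thr y n)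
    @[n --> \oo] --> expR (- y) ^+ k.
  rewrite -[X in _ --> X]mulr1; apply: cvgM.
    by have := @cvg_expXpow _ y k k; rewrite -mulrN expRM_natl.
  rewrite -[X in _ --> X]subr0 -[X in _ --> _ - X](mulr0 (k%:R ^+ 2)).
  by apply: cvgB; [exact: cvg_cst|apply: cvgM; [exact: cvg_cst|exact: cvg_thr]].
near=> n => V Vk.
have t0 : 0 < thr y n by near: n; exact: thr_gt0.
have t1 : thr y n <= 2^-1 by near: n; apply: near_thr_le.
have t01 : 0 < thr y n < 1 by rewrite t0/=; lra.
have tk : k%:R * thr y n <= 1.
  rewrite mulrC -ler_pdivlMr ?ltr0n//; near: n; apply: near_thr_le.
  by rewrite divr_gt0 ?ltr0n.
have up : n%:R ^+ k * mean_avoidance (n - k) V <= a k n.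
  by move: V Vk; near: n.
have h1 : `|expR (- y) ^+ k - a k n| <= e by near: n; move/cvgrPdist_le : al; apply.
have h2 : `|expR (- y) ^+ k - n%:R ^+ k * (1 - k%:R * thr y n) ^+ (n - k) *
    (1 - k%:R ^+ 2 * thr y n)| <= e by near: n; move/cvgrPdist_le : lo; apply.
rewrite (nu_exceedances (thr y n) mS S1 (nu_box (n := n))) Vk -/(mean_avoidance _ _).
have low : (1 - k%:R * thr y n) ^+ (n - k) * (1 - k%:R ^+ 2 * thr y n) <=
    mean_avoidance (n - k) V.
  rewrite -lee_fin -mean_avoidanceE -Vk.
  by apply: (integral_avoidance_ge sphere0 t01 mS S1 (nu_box (n := n))); rewrite Vk.
have {}low := ler_wpM2l (exprn_ge0 k (ler0n R n)) low; rewrite mulrA in low.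
by move: h1 h2; rewrite !ler_norml => /andP[? ?] /andP[? ?]; apply/andP; split; lra.
Unshelve. all: by end_near. Qed.

End factorial_moments.

(** * The exceedance count *)

Lemma measure_fibers d (T : measurableType d) (R : realType)
    (m : {measure set T -> \bar R}) (I : finType) (E : T -> I) (Q : pred I) :
  (forall J, measurable [set x | E x = J]) ->
  m [set x | Q (E x)] = (\sum_(J | Q J) m [set x | E x = J])%E.
Proof.
move=> mE.
have mEs (s : seq I) : measurable [set x | E x \in s].
  elim: s => [|J s IH]; first by rewrite (_ : [set _ | _] = set0)//; apply/seteqP; split.
  rewrite (_ : [set _ | _] = [set x | E x = J] `|` [set x | E x \in s]).
    exact: measurableU.
  by apply/seteqP; split => x /=; rewrite inE => /predU1P.
suff H (s : seq I) : uniq s ->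
    m [set x | E x \in s] = (\sum_(J <- s) m [set x | E x = J])%E.
  rewrite -[RHS]big_enum -H ?enum_uniq//; congr (m _).
  by apply/seteqP; split => x /=; rewrite mem_enum.
elim: s => [_|J s IH /= /andP[Js us]].
  by rewrite big_nil (_ : [set _ | _] = set0) ?measure0//; apply/seteqP; split.
rewrite big_cons -IH// -measureU//; last first.
  by apply/seteqP; split => // x [/= ->]; rewrite (negbTE Js).
congr (m _); apply/seteqP; split => x /=; first by rewrite inE => /predU1P.
by rewrite inE => -[->|->]; rewrite ?eqxx ?orbT.
Qed.

Section sample.
Context {dO : measure_display} {Omega : measurableType dO} {R : realType}.
Context {d : measure_display} {T : measurableType d}.
Variables (P : probability Omega R) (X : nat -> {RV P >-> T}).
Variable mu : probability T R.

Definition sample n (w : Omega) : n.-tuple T := [tuple X i w | i < n].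

Lemma measurable_sample n : measurable_fun setT (sample n).
Proof.
apply/measurable_fun_tnthP => i.
by rewrite (_ : _ \o _ = X i)//; apply/funext => w /=; rewrite tnth_mktuple.
Qed.

HB.instance Definition _ n := isMeasurableFun.Build _ _ _ _ (sample n)
  (@measurable_sample n).

Lemma distribution_sample_box n (A : 'I_n -> set T) :
  mutually_independent X -> common_distribution X mu ->
  (forall i, measurable (A i)) ->
  distribution P (sample n) (box A) = (\prod_(i < n) mu (A i))%E.
Proof.
move=> indep law mA.
(* Independence is stated for families indexed by all naturals, so [A] is extended by the whole
   space. *)
pose A' k := if insub k is Some i then A i else setT.
have mA' k : measurable (A' k) by rewrite /A'; case: insub.
have A'E (i : 'I_n) : A' i = A i.
  by rewrite /A' insubT//= => ni; congr A; exact/val_inj.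
pose J := [fset k in iota 0 n]%fset.
transitivity (P (\bigcap_(i in [set` J]) (X i @^-1` A' i))).
  congr (P _); apply/seteqP; split => w /=.
    move=> Hw k; rewrite /J /= !inE mem_iota add0n => kn.
    by have := Hw (Ordinal kn); rewrite tnth_mktuple -A'E.
  move=> Hw i; rewrite tnth_mktuple -A'E; apply: Hw.
  by rewrite /J /= !inE mem_iota add0n ltn_ord.
rewrite indep//.
rewrite (perm_big (index_iota 0 n))/=; last first.
  apply: uniq_perm; [exact: fset_uniq|exact: iota_uniq|].
  by move=> k; rewrite /index_iota subn0 !inE.
rewrite big_mkord; apply: eq_bigr => i _.
by rewrite -A'E; exact: law.
Qed.

End sample.

Section nearest_neighbor_cells.
Context {R : realType} {d : nat}.
Variable mu : probability (d.-tuple R) R.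
Variables (x : nat -> d.-tuple R) (n : nat).

Lemma nn_distP (i : 'I_n) : (1 < n)%N -> exists j : 'I_n, [/\ j != i,
  nn_dist x n i = eucl_dist (x i) (x j) &
  forall k : 'I_n, k != i -> nn_dist x n i <= eucl_dist (x i) (x k)].
Proof.
move=> n1; have [j0 j0i] : exists j : 'I_n, j != i.
  have n0 : (0 < n)%N := ltnW n1.
  have [i0|i0] := eqVneq (i : nat) 0%N.
    by exists (Ordinal n1); rewrite -val_eqE /= i0.
  by exists (Ordinal n0); rewrite -val_eqE /= eq_sym.
pose F (j : 'I_n) := (eucl_dist (x i) (x j))%:E.
have minE : (\big[Order.min/+oo%E]_(j < n | j != i :> nat) F j =
    F [arg min_(j < j0 | j != i :> nat) F j]%O)%E.
  by rewrite (bigmin_eq_arg _ j0)// => j _; rewrite leey.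
rewrite /nn_dist -/(F _) minE.
by case: arg_minP => // j ji jmin; exists j.
Qed.

(** The minimum is attained and [ball_mass] is nondecreasing in the radius, so the mass exceeds [t]
    at the nearest-neighbour distance iff it does at the distance of every other point. *)
Lemma nn_mass_gt (t : R) (i : 'I_n) : (1 < n)%N ->
  t < nn_mass mu x n i <->
  exceedance mu t i [tuple x k | k < n].
Proof.
move=> n1; have [j [ji dj dmin]] := nn_distP i n1.
rewrite /nn_mass -/(ball_mass mu (x i) (nn_dist x n i)).
split => [tG k ki|H].
  have dk : nn_dist x n i <= eucl_dist (x k) (x i) by rewrite eucl_distC dmin.
  rewrite /dilated_cell /= !tnth_mktuple divr1 => Gt.
  have := lt_le_trans tG (le_trans (le_ball_mass mu (x i) dk) Gt).
  by rewrite ltxx.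
have := H j ji; rewrite /dilated_cell /= !tnth_mktuple divr1 dj eucl_distC.
by move=> /negP; rewrite -ltNge.
Qed.

End nearest_neighbor_cells.

Lemma poisson_lawE (R : realType) (rate x : R) (m : nat) : 0 < rate ->
  (forall j, (j%:R <= x) = (j < m)%N) ->
  poisson_law rate `]-oo, x]%classic =
  (\sum_(j < m) rate ^+ j / j`!%:R * expR (- rate))%:E.
Proof.
move=> r0 xm.
have -> : poisson_law rate `]-oo, x]%classic =
    (\esum_(k in `I_m) (poisson_pmf rate k)%:E)%E.
  transitivity (poisson_prob rate 0 (natR @^-1` `]-oo, x]%classic)); first by [].
  rewrite /poisson_prob r0; congr esum.
  by apply/seteqP; split => j /=; rewrite in_itv /= xm.
rewrite esum_fset//; last by move=> j _; rewrite lee_fin poisson_pmf_ge0.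
rewrite -fsbig_ord sumEFin; congr (_%:E); apply: eq_bigr => j _.
by rewrite /poisson_pmf r0.
Qed.

Section exceedance_set.
Context {dO : measure_display} {Omega : measurableType dO} {R : realType}.
Context {d : nat}.
Variables (P : probability Omega R) (X : nat -> {RV P >-> d.-tuple R}).
Variables (mu : probability (d.-tuple R) R) (y : R) (n : nat).

Definition exceedance_set (z : n.-tuple (d.-tuple R)) : {set 'I_n} :=
  finset (fun i => `[< exceedance mu (thr y n) i z >]).

Lemma measurable_exceedance_set (J : {set 'I_n}) :
  measurable [set z | exceedance_set z = J].
Proof.
rewrite (_ : [set _ | _] = [set z | forall i, (i \in J -> exceedance mu (thr y n) i z) /\
    (i \notin J -> ~ exceedance mu (thr y n) i z)]).
  apply: measurable_forall => i; apply: measurableI.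
    by apply: measurable_imply; exact: measurable_exceedance.
  by apply: measurable_imply; apply: measurableC; exact: measurable_exceedance.
apply/seteqP; split => z /=.
  by move=> <- i; rewrite inE; split => [/asboolP|/asboolP].
move=> H; apply/setP => i; rewrite inE; have [Hi Hni] := H i.
by apply/asboolP/idP => [|//]; apply: contraPT => /Hni.
Qed.

Lemma sub_exceedance_set (A : {set 'I_n}) z :
  A \subset exceedance_set z <-> forall i, i \in A -> exceedance mu (thr y n) i z.
Proof.
split => [/fintype.subsetP H i /H|H]; first by rewrite inE => /asboolP.
by apply/fintype.subsetP => i iA; rewrite inE; apply/asboolP; exact: H.
Qed.

Lemma thr_lt (m : R) : (0 < n)%N -> (y + ln n%:R < n%:R * m) = (thr y n < m).
Proof. by move=> n0; rewrite /thr /logy ltr_pdivrMr ?ltr0n// mulrC. Qed.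

Lemma exceedancesE w : (1 < n)%N ->
  exceedances mu X y n w = #|exceedance_set (sample X n w)|%:R.
Proof.
move=> n1; rewrite /exceedances -sum1_card natr_sum big_mkcond.
rewrite [RHS]big_mkcond; apply: eq_bigr => i _ /=; rewrite indicE inE.
rewrite (_ : (w \in _) = `[< exceedance mu (thr y n) i (sample X n w) >]).
  by case: ifP.
apply/idP/asboolP; rewrite inE /= thr_lt ?(ltnW n1)// => H.
  exact: (nn_mass_gt mu (X ^~ w) (thr y n) i n1).1 H.
exact: (nn_mass_gt mu (X ^~ w) (thr y n) i n1).2 H.
Qed.

(** The maximum starts from [0], hence the nonnegative threshold. *)
Lemma max_nn_mass_le w : (1 < n)%N -> 0 <= thr y n ->
  (n%:R * max_nn_mass mu (X ^~ w) n - ln n%:R <= y) =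
  (#|exceedance_set (sample X n w)| == 0)%N.
Proof.
move=> n1 t0; rewrite lerBlDr -[LHS]negbK -ltNge thr_lt ?(ltnW n1)// cards_eq0 -leNgt.
apply/idP/eqP => [H|H].
  apply/setP => i; rewrite !inE; apply/asboolP => Ei.
  have Hi := (nn_mass_gt mu (X ^~ w) (thr y n) i n1).2 Ei.
  have : nn_mass mu (X ^~ w) n i <= thr y n by apply: le_trans H; exact: le_bigmax.
  by rewrite leNgt Hi.
apply/bigmax_leP; split => // i _; rewrite leNgt; apply/negP => Hi.
have : i \in exceedance_set (sample X n w).
  by rewrite inE; apply/asboolP; exact: (nn_mass_gt mu (X ^~ w) (thr y n) i n1).1 Hi.
by rewrite H inE.
Qed.

End exceedance_set.

(** Turns a distribution function of an integer count at [x] into a sum of finitely many point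
    probabilities. *)
Lemma natr_le_ltn (R : realType) (x : R) :
  exists m, forall j, (j%:R <= x) = (j < m)%N.
Proof.
have [x0|x0] := leP 0 x; last first.
  by exists 0%N => j; rewrite ltn0; apply/negbTE; rewrite -ltNge (lt_le_trans x0).
by exists (Num.truncn x).+1 => j; rewrite ltnS truncn_ge_nat.
Qed.

Theorem theorem2 (R : realType) (d : nat) (d_ge1 : (1 <= d)%N)
    (dO : measure_display) (Omega : measurableType dO)
    (P : probability Omega R) (X : nat -> {RV P >-> d.-tuple R})
    (mu : probability (d.-tuple R) R) (f : d.-tuple R -> R)
    (X_indep : mutually_independent X)
    (X_law : common_distribution X mu)
    (mu_density : has_density mu (lebesgue_tuple d) f)
    (beta cmax delta : R) (beta01 : 0 < beta < 1) (delta_gt0 : 0 < delta)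
    (mu_balls : forall (r s : R) (x z : d.-tuple R),
       0 < r -> 0 < s -> measure_supp mu x -> measure_supp mu z ->
       Num.max r s <= eucl_dist x z ->
       mu (eucl_ball x r) = mu (eucl_ball z s) -> (mu (eucl_ball z s) <= delta%:E)%E ->
       fine (mu (eucl_ball x r `&` eucl_ball z s)) / fine (mu (eucl_ball z s)) <= beta /\
       (mu (eucl_ball z (2 * s)) <= cmax%:E * mu (eucl_ball z s))%E) :
  (forall y : R,
     cvg_in_distribution (fun n => exceedances mu X y n : {RV P >-> R})
       (poisson_law (expR (- y)))) /\
  (forall y : R,
     P [set w | n%:R * max_nn_mass mu (X ^~ w) n - ln n%:R <= y]
       @[n --> \oo] --> (expR (- expR (- y)))%:E).
Proof.
(* Spheres are Lebesgue null, hence null for a measure with a density. *)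
have sphere0 (x : d.-tuple R) r : mu [set z | eucl_dist z x = r] = 0%E.
  have [mf f0 muE] := mu_density.
  have mS := measurable_sphere x r.
  rewrite muE//; apply: null_set_integral => //; last exact: lebesgue_tuple_sphere.
  by apply/measurable_EFinP; exact: measurable_funTS.
have [S [mS S1 Ssupp]] := measure_supp_full mu.
pose nu n : probability (n.-tuple (d.-tuple R)) R := distribution P (sample X n).
have nu_box n (A : 'I_n -> set (d.-tuple R)) : (forall i, measurable (A i)) ->
    nu n (box A) = (\prod_(i < n) mu (A i))%E.
  exact: distribution_sample_box.
(* The weights fed to [poisson_of_factorial_moments]: their sum over the sets [J] containing [A] is
   the probability that all points of [A] exceed. *)
pose p (y : R) n (J : {set 'I_n}) : R :=
  fine (nu n [set z | exceedance_set mu y z = J]).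
have pE y n (Q : pred {set 'I_n}) :
    nu n [set z | Q (exceedance_set mu y z)] = (\sum_(J | Q J) p y n J)%:E.
  rewrite measure_fibers; last exact: measurable_exceedance_set.
  rewrite -sumEFin; apply: eq_bigr => J _; rewrite fineK// fin_num_measure//.
  exact: measurable_exceedance_set.
have count_cvg y j : (\sum_(J : {set 'I_n} | #|J| == j) p y n J) @[n --> \oo] -->
    expR (- y) ^+ j / j`!%:R * expR (- expR (- y)).
  apply: (@poisson_of_factorial_moments _ _ (p y)) => [n J|k e e0]; first exact: fine_ge0.
  have := near_factorial_moment sphere0 beta01 delta_gt0 mu_balls nu_box mS S1 Ssupp y k e0.
  apply: filterS => n H A Ak; have := H A Ak; congr (`|_ * _ - _| <= _).
  rewrite (_ : [set _ | _] = [set z | A \subset exceedance_set mu y z]).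
    by rewrite (pE y n (fun J => A \subset J)).
  by apply/seteqP; split => z /sub_exceedance_set.
split => y.
  move=> x _; have [m xm] := natr_le_ltn x.
  rewrite (poisson_lawE (expR_gt0 _) xm).
  have lim : (\sum_(j < m) \sum_(J : {set 'I_n} | #|J| == j) p y n J)%:E @[n --> \oo] -->
      (\sum_(j < m) expR (- y) ^+ j / j`!%:R * expR (- expR (- y)))%:E.
    apply: cvg_EFin; first by apply: nearW.
    apply: cvg_big => [|j _]; [by apply: add_continuous|exact: count_cvg].
  apply: cvg_trans (near_eq_cvg _) lim; near=> n.
  have n1 : (1 < n)%N by near: n; exact: nbhs_infty_gt.
  transitivity (nu n [set z | (fun J : {set 'I_n} => #|J| < m)%N (exceedance_set mu y z)]).
    rewrite (pE y n (fun J => #|J| < m)%N); congr (_%:E).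
    rewrite (exchange_big_dep (fun J : {set 'I_n} => #|J| < m)%N)/=; last first.
      by move=> j J _ /eqP ->.
    apply: eq_bigr => J Jm; by rewrite (big_pred1 (Ordinal Jm)).
  transitivity (P [set w | (#|exceedance_set mu y (sample X n w)| < m)%N]); first by [].
  transitivity (P (exceedances mu X y n @^-1` `]-oo, x]%classic)); last by [].
  congr (P _).
  by apply/seteqP; split => w /=; rewrite in_itv /= exceedancesE// xm.
(* The maximum is at most the threshold iff no point exceeds it, so the limit is the Poisson
   probability of [0]. *)
have := count_cvg y 0%N; rewrite expr0 fact0 divr1 mul1r => lim.
have {}lim : (\sum_(J : {set 'I_n} | #|J| == 0%N) p y n J)%:E @[n --> \oo] -->
    (expR (- expR (- y)))%:E by apply: cvg_EFin => //; apply: nearW.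
apply: cvg_trans (near_eq_cvg _) lim; near=> n.
have n1 : (1 < n)%N by near: n; exact: nbhs_infty_gt.
have t0 : 0 < thr y n by near: n; exact: thr_gt0.
rewrite -(pE y n (fun J => #|J| == 0%N)).
transitivity (P [set w | #|exceedance_set mu y (sample X n w)| == 0%N]); first by [].
congr (P _).
by apply/seteqP; split => w /=; rewrite max_nn_mass_le// ltW.
Unshelve. all: by end_near. Qed.
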